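(* Let $\mathscr A,\mathscr B$ be two strictly unital $A_\infty$-categories and let $F,G:\mathscr A\to\mathscr B$ be strictly unital $A_\infty$-functors. If $F\approx G$, then $[F]=[G]$ in $\mathrm{Ho}(A_\infty\mathrm{Cat})$.
   Context: $R$ is a commutative ring; categories are small. A non unital $A_\infty$-category $\mathscr A$ is a graded $R$-linear quiver (a set of objects and graded $R$-modules $\mathrm{Hom}(x,y)$) with $R$-linear maps $m^n_{\mathscr A}:\mathrm{Hom}(x_{n-1},x_n)\otimes\cdots\otimes\mathrm{Hom}(x_0,x_1)\to\mathrm{Hom}(x_0,x_n)[2-n]$ ($n\ge1$) such that $\sum_{m=1}^n\sum_{d=0}^{n-m}(-1)^{\dagger_d}m^{n-m+1}(f_n,\dots,f_{d+m+1},m^m(f_{d+m},\dots,f_{d+1}),f_d,\dots,f_1)=0$, with $\dagger_d=\sum_{i\le d}\deg f_i-d$. It is strictly unital if every $x$ has a closed degree $0$ morphism $1_x$ with $m^2(f,1_x)=f=(-1)^{\deg f}m^2(1_y,f)$ for $f:x\to y$, and $m^n(\dots,1_x,\dots)=0$ for $n\ge3$. A strictly unital $A_\infty$-functor $F:\mathscr A\to\mathscr B$ is a map $F^0$ on objects and $R$-linear maps $F^n:\mathrm{Hom}_{\mathscr A}(x_{n-1},x_n)\otimes\cdots\otimes\mathrm{Hom}_{\mathscr A}(x_0,x_1)\to\mathrm{Hom}_{\mathscr B}(F^0x_0,F^0x_n)[1-n]$, $n\ge1$, with $\sum_r\sum_{s_1+\dots+s_r=n}m^r_{\mathscr B}(F^{s_r}(f_n,\dots),\dots,F^{s_1}(f_{s_1},\dots,f_1))=\sum_{m,k}(-1)^{\dagger_k}F^{n-m+1}(f_n,\dots,m^m_{\mathscr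 A}(f_{k+m},\dots,f_{k+1}),f_k,\dots,f_1)$, $F^1(1_x)=1_{F^0x}$ and $F^n(\dots,1_x,\dots)=0$ for $n\ge2$. $F$ is a quasi-equivalence if each $F^1$ is a quasi-isomorphism for $m^1$ and $H^0(F)$ is essentially surjective. $A_\infty\mathrm{Cat}$ is the category of strictly unital $A_\infty$-categories and strictly unital $A_\infty$-functors; $\mathrm{Ho}(A_\infty\mathrm{Cat})$ is its localization at quasi-equivalences and $[F]$ is the image of $F$ there. A prenatural transformation $T:F\Rightarrow G$ of degree $g$ consists of $T^0(x)\in\mathrm{Hom}_{\mathscr B}(F^0x,G^0x)$ of degree $g$ and $R$-linear maps $T^n:\mathrm{Hom}_{\mathscr A}(x_{n-1},x_n)\otimes\cdots\otimes\mathrm{Hom}_{\mathscr A}(x_0,x_1)\to\mathrm{Hom}_{\mathscr B}(F^0x_0,G^0x_n)[g-n]$, $n\ge1$; it is strictly unital if $T^n(f_n,\dots,f_1)=0$ whenever $n\ge1$ and some $f_j$ is a unit $1_x$. Differential: $\mathfrak M^1(T)^n(f_n,\dots,f_1)=\sum_{r,i}\sum_{s_1+\dots+s_r=n}(-1)^{\dagger}m^r_{\mathscr B}(G^{s_r}(f_n,\dots),\dots,G^{s_{i+1}}(\dots),T^{s_i}(\dots),F^{s_{i-1}}(\dots),\dots,F^{s_1}(\dots,f_1))-\sum_{m,k}(-1)^{\dagger_k+g-1}T^{n-m+1}(f_n,\dots,m^m_{\mathscr A}(f_{k+m},\dots,f_{k+1}),f_k,\dots,f_1)$ with $s_i\ge0$,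 other $s_j\ge1$, $\dagger=(g-1)\sum_{l\le s_1+\dots+s_{i-1}}(\deg f_l-1)$. Composition of $T_1:F\Rightarrow G$, $T_2:G\Rightarrow K$: $\mathfrak M^2(T_2,T_1)^n(f_n,\dots,f_1)=\sum(-1)^{\circ}m^r_{\mathscr B}(K^{s_r},\dots,T_2^{s_j},G^{s_{j-1}},\dots,G^{s_{i+1}},T_1^{s_i},F^{s_{i-1}},\dots,F^{s_1})$, $\circ=(\deg T_1-1)\sum_{l\le s_1+\dots+s_{i-1}}(\deg f_l-1)+(\deg T_2-1)\sum_{l\le s_1+\dots+s_{j-1}}(\deg f_l-1)$ (arguments inserted in order). $F\approx G$ (weakly equivalent): there are $\mathfrak M^1$-closed degree $0$ transformations $T:F\Rightarrow G$, $S:G\Rightarrow F$ and transformations $H:F\Rightarrow F$, $H':G\Rightarrow G$ with $\mathfrak M^2(S,T)=\mathrm{Id}_F+\mathfrak M^1(H)$ and $\mathfrak M^2(T,S)=\mathrm{Id}_G+\mathfrak M^1(H')$, where $\mathrm{Id}_F^0(x)=1_{F^0x}$ and $\mathrm{Id}_F^n=0$ for $n>0$; here all prenatural transformations are taken to be strictly unital. *)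

(* Defs.v *)
From mathcomp Require Import all_boot all_algebra.
From mathcomp Require Import zify.
From mathcomp Require Import boolp.

Set Implicit Arguments.
Unset Strict Implicit.
Unset Printing Implicit Defensive.

Import GRing.Theory.

Local Open Scope ring_scope.

(* A chain from x to z is a string x = x_0 -> x_1 -> ... -> x_n = z of        *)
(* composable edges f_1, ..., f_n, listed from the source on: the arguments   *)
(* written (f_n, ..., f_1) in A_infinity formulas form the chain              *)
(* ccons f_1 (... (ccons f_n (cnil x_n))).                                    *)
Inductive chain (O : Type) (E : O -> O -> Type) : O -> O -> Type :=
| cnil x : chain E x x
| ccons x y z of E x y & chain E y z : chain E x z.
Arguments cnil {O E} x.
Arguments ccons {O E x y z}.

Section Chains.
Context {O : Type} {E : O -> O -> Type}.

Definition chain1 x y (f : E x y) : chain E x y := ccons f (cnil y).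

Fixpoint csize x z (p : chain E x z) : nat :=
  if p is ccons _ _ _ _ p' then (csize p').+1 else 0.

Fixpoint ccat x y (p : chain E x y) : forall z, chain E y z -> chain E x z :=
  match p in chain _ x y return forall z, chain E y z -> chain E x z with
  | cnil _ => fun z q => q
  | ccons _ _ _ f p' => fun z q => ccons f (ccat p' q)
  end.

Record csplit x z := CSplit
  { cmid : O; cfst : chain E x cmid; csnd : chain E cmid z }.

Definition csplit_cons x y z (f : E x y) (s : csplit y z) : csplit x z :=
  CSplit (ccons f (cfst s)) (csnd s).

(* All the n + 1 ways of writing p as ccat p1 p2, empty pieces included. *)
Fixpoint splits x z (p : chain E x z) : seq (csplit x z) :=
  CSplit (cnil x) p ::
  match p with
  | cnil _ => [::]
  | ccons _ _ _ f p' => [seq csplit_cons f s | s <- splits p']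
  end.

(* Adds f in front of the first block, if there is one. *)
Definition first_block_cons y z (q : chain (chain E) y z) :
    forall x, E x y -> seq (chain (chain E) x z) :=
  match q in chain _ y z return forall x, E x y -> seq (chain (chain E) x z)
  with
  | cnil _ => fun _ _ => [::]
  | ccons _ _ _ b q' => fun _ f => [:: ccons (ccons f b) q']
  end.

(* All the ways of cutting p into consecutive nonempty blocks, that is, all   *)
(* r and s_1 + ... + s_r = n with s_j >= 1; each one is a chain of chains.    *)
Fixpoint blocks x z (p : chain E x z) : seq (chain (chain E) x z) :=
  match p with
  | cnil x => [:: cnil x]
  | ccons _ _ _ f p' =>
      flatten [seq ccons (chain1 f) q :: first_block_cons q f | q <- blocks p']
  end.

End Chains.

Fixpoint chmap (O1 O2 : Type) (E1 : O1 -> O1 -> Type) (E2 : O2 -> O2 -> Type)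
    (phi : O1 -> O2) (h : forall x y, E1 x y -> E2 (phi x) (phi y))
    x z (p : chain E1 x z) : chain E2 (phi x) (phi z) :=
  match p with
  | cnil x => cnil (phi x)
  | ccons _ _ _ f p' => ccons (h _ _ f) (chmap h p')
  end.

Section ChainTheory.
Context {O : Type} {E : O -> O -> Type}.

Lemma ccatA x y z t (p : chain E x y) (q : chain E y z) (r : chain E z t) :
  ccat p (ccat q r) = ccat (ccat p q) r.
Proof. by elim: p q => //= ? ? ? f p IH q; rewrite IH. Qed.

Lemma ccat0 x y (p : chain E x y) : ccat p (cnil y) = p.
Proof. by elim: p => //= ? ? ? f p ->. Qed.

Lemma csize_cat x y z (p : chain E x y) (q : chain E y z) :
  csize (ccat p q) = (csize p + csize q)%N.
Proof. by elim: p q => //= ? ? ? f p IH q; rewrite IH. Qed.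

Section Sums.
Variable V : nmodType.

Lemma sum_splitsS x y z (f : E x y) (p : chain E y z)
    (phi : forall y, chain E x y -> chain E y z -> V) :
  \sum_(s <- splits (ccons f p)) phi _ (cfst s) (csnd s) =
  phi _ (cnil x) (ccons f p) +
  \sum_(s <- splits p) phi _ (ccons f (cfst s)) (csnd s).
Proof. by rewrite /= big_cons big_map. Qed.

Lemma sum_blocks0 x (phi : chain (chain E) x x -> V) :
  \sum_(q <- blocks (cnil x)) phi q = phi (cnil x).
Proof. by rewrite /= big_seq1. Qed.

Lemma sum_blocksS x y z (f : E x y) (p : chain E y z)
    (phi : chain (chain E) x z -> V) :
  \sum_(q <- blocks (ccons f p)) phi q =
  \sum_(q <- blocks p)
     (phi (ccons (chain1 f) q) + \sum_(q' <- first_block_cons q f) phi q').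
Proof.
rewrite /= big_flatten big_map; apply: eq_bigr => q _.
by rewrite big_cons.
Qed.

Lemma splitsA x z (p : chain E x z)
    (phi : forall y y', chain E x y -> chain E y y' -> chain E y' z -> V) :
  \sum_(s <- splits p) \sum_(t <- splits (cfst s))
     phi _ _ (cfst t) (csnd t) (csnd s) =
  \sum_(s <- splits p) \sum_(t <- splits (csnd s))
     phi _ _ (cfst s) (cfst t) (csnd t).
Proof.
elim: p phi => [x0|x0 y0 z0 f p IH] phi.
  by rewrite /= !big_seq1.
rewrite (sum_splitsS f p (fun y (a : chain E x0 y) b =>
  \sum_(t <- splits a) phi _ _ (cfst t) (csnd t) b)).
rewrite (sum_splitsS f p (fun y (a : chain E x0 y) b =>
  \sum_(t <- splits b) phi _ _ a (cfst t) (csnd t))).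
rewrite big_seq1 /=.
rewrite (sum_splitsS f p (fun y a b => phi _ _ (cnil x0) a b)) -addrA.
congr (_ + _).
rewrite -(IH (fun _ _ a b c => phi _ _ (ccons f a) b c)) -big_split /=.
apply: eq_bigr => s _.
by rewrite (sum_splitsS f (cfst s) (fun _ a b => phi _ _ a b (csnd s))).
Qed.

End Sums.
End ChainTheory.

Section BlockSums.
Context {O : Type} {E : O -> O -> Type} (V : nmodType).

Lemma sum_first_block_splits x y z (f : E x y) (q : chain (chain E) y z)
    (phi : forall y, chain (chain E) x y -> chain (chain E) y z -> V) :
  \sum_(q' <- first_block_cons q f) \sum_(s <- splits q')
     phi _ (cfst s) (csnd s) =
  \sum_(q' <- first_block_cons q f) phi _ (cnil x) q' +
  \sum_(s <- splits q) \sum_(a <- first_block_cons (cfst s) f)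
     phi _ a (csnd s).
Proof.
case: q f phi => [y1|y1 y2 y3 b q] f phi.
  by rewrite /= !(big_nil, big_seq1) addr0.
rewrite [first_block_cons _ _]/= 2!big_seq1.
rewrite (sum_splitsS _ q phi); congr (_ + _).
rewrite (sum_splitsS _ q (fun y a c => \sum_(a' <- first_block_cons a f)
  phi y a' c)) /= big_nil add0r.
by apply: eq_bigr => s _; rewrite big_seq1.
Qed.

Lemma sum_blocks_splits x z (p : chain E x z)
    (phi : forall y, chain (chain E) x y -> chain (chain E) y z -> V) :
  \sum_(q <- blocks p) \sum_(s <- splits q) phi _ (cfst s) (csnd s) =
  \sum_(s <- splits p) \sum_(q1 <- blocks (cfst s))
    \sum_(q2 <- blocks (csnd s)) phi _ q1 q2.
Proof.
elim: p phi => [x0|x0 y0 z0 f p IH] phi; first by rewrite /= !big_seq1.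
rewrite (sum_splitsS f p (fun y a b =>
  \sum_(q1 <- blocks a) \sum_(q2 <- blocks b) phi y q1 q2)).
rewrite sum_blocks0 !sum_blocksS.
pose psi y (a : chain (chain E) y0 y) (b : chain (chain E) y z0) :=
  phi _ (ccons (chain1 f) a) b + \sum_(q' <- first_block_cons a f) phi _ q' b.
under [X in _ + X]eq_bigr => s _.
  rewrite (sum_blocksS f (cfst s)
    (fun q => \sum_(q2 <- blocks (csnd s)) phi _ q q2)).
  under eq_bigr => q _ do rewrite exchange_big -big_split /=.
  over.
rewrite -(IH psi) -big_split; apply: eq_bigr => q _ /=.
rewrite (sum_splitsS _ q phi) sum_first_block_splits {}/psi big_split /=.
by rewrite !addrA; congr (_ + _); rewrite addrAC.
Qed.

(* All the chains obtained by replacing each edge b of q by an element of c b. *)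
Fixpoint choices (P : Type) (D D' : P -> P -> Type)
    (c : forall x y, D x y -> seq (D' x y)) x z (q : chain D x z) :
    seq (chain D' x z) :=
  match q with
  | cnil x => [:: cnil x]
  | ccons _ _ _ b q' => [seq ccons b' q'' | b' <- c _ _ b, q'' <- choices c q']
  end.

End BlockSums.

Section BlockSums2.
Context {O : Type} {E : O -> O -> Type} (V : nmodType).

Lemma sum_choicesS (D D' : O -> O -> Type)
    (c : forall x y, D x y -> seq (D' x y)) x y z (b : D x y) (q : chain D y z)
    (phi : chain D' x z -> V) :
  \sum_(r <- choices c (ccons b q)) phi r =
  \sum_(b' <- c _ _ b) \sum_(r <- choices c q) phi (ccons b' r).
Proof. by rewrite /= big_allpairs_dep. Qed.

Definition in_first_block y z (Q : chain (chain (chain E)) y z) :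
    forall x, E x y -> seq (chain (chain (chain E)) x z) :=
  match Q in chain _ y z
    return forall x, E x y -> seq (chain (chain (chain E)) x z)
  with
  | cnil _ => fun _ _ => [::]
  | ccons _ _ _ B Q' => fun _ f => [seq ccons B' Q' | B' <- first_block_cons B f]
  end.

Lemma sum_first_block_blocks x y z (f : E x y) (q : chain (chain E) y z)
    (phi : chain (chain (chain E)) x z -> V) :
  \sum_(q' <- first_block_cons q f) \sum_(Q <- blocks q') phi Q =
  \sum_(Q <- blocks q) \sum_(Q' <- in_first_block Q f) phi Q'.
Proof.
case: q f phi => [y1|y1 y2 y3 b q] f phi; first by rewrite /= big_nil big_seq1 big_nil.
rewrite [first_block_cons _ _]/= big_seq1 (sum_blocksS _ q phi).
rewrite (sum_blocksS b q); apply: eq_bigr => Q _.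
congr (_ + _); first by rewrite /= big_seq1.
by case: Q b phi => [y4|y4 y5 y6 B Q] b phi /=;
  rewrite ?big_nil ?big_seq1 //= big_seq1.
Qed.

Lemma sum_first_block_choices x y z (f : E x y) (q : chain (chain E) y z)
    (phi : chain (chain (chain E)) x z -> V) :
  \sum_(q' <- first_block_cons q f)
     \sum_(Q <- choices (@blocks O E) q') phi Q =
  \sum_(Q <- choices (@blocks O E) q)
     (\sum_(Q' <- first_block_cons Q (chain1 f)) phi Q' +
      \sum_(Q' <- in_first_block Q f) phi Q').
Proof.
case: q f phi => [y1|y1 y2 y3 b q] f phi.
  by rewrite /= big_nil big_seq1 !big_nil addr0.
rewrite [first_block_cons _ _]/= big_seq1 !sum_choicesS sum_blocksS.
apply: eq_bigr => B _; rewrite exchange_big -big_split /=.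
by apply: eq_bigr => Q _; rewrite big_seq1 big_map.
Qed.

Lemma sum_blocks_blocks x z (p : chain E x z)
    (phi : chain (chain (chain E)) x z -> V) :
  \sum_(q <- blocks p) \sum_(Q <- blocks q) phi Q =
  \sum_(q <- blocks p) \sum_(Q <- choices (@blocks O E) q) phi Q.
Proof.
elim: p phi => [x0|x0 y0 z0 f p IH] phi; first by rewrite /= !big_seq1.
rewrite !(sum_blocksS f p).
under eq_bigr => q _ do
  rewrite sum_first_block_blocks (sum_blocksS (chain1 f) q) -big_split /=.
under [RHS]eq_bigr => q _ do
  rewrite sum_first_block_choices sum_choicesS /= big_seq1 -big_split /=.
rewrite (IH (fun Q => phi (ccons (chain1 (chain1 f)) Q) +
  \sum_(q' <- first_block_cons Q (chain1 f)) phi q' +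
  \sum_(Q' <- in_first_block Q f) phi Q')).
by apply: eq_bigr => q _; apply: eq_bigr => Q _; rewrite addrA.
Qed.

Lemma sum_blocks_head x y z (e : E x y) (c : chain E y z)
    (phi : chain (chain E) x z -> V) :
  \sum_(q <- blocks (ccons e c)) phi q =
  \sum_(s <- splits c) \sum_(q <- blocks (csnd s)) phi (ccons (ccons e (cfst s)) q).
Proof.
elim: c x e phi => [y0|y0 y1 z0 f c IH] x0 e phi.
  by rewrite /= !big_seq1.
rewrite sum_blocksS big_split /=.
rewrite (sum_splitsS f c (fun y a b => \sum_(q <- blocks b) phi (ccons (ccons e a) q))).
congr (_ + _); rewrite IH; apply: eq_bigr => s _.
by apply: eq_bigr => q _ /=; rewrite big_seq1.
Qed.

Lemma sum_splits_eq0 x z (p : chain E x z)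
    (phi : forall y, chain E x y -> chain E y z -> V) :
  (forall y (a : chain E x y) b,
     (csize a + csize b = csize p)%N -> phi _ a b = 0) ->
  \sum_(s <- splits p) phi _ (cfst s) (csnd s) = 0.
Proof.
elim: p phi => [x0|x0 y0 z0 f p IH] phi H; first by rewrite /= big_seq1 H.
rewrite (sum_splitsS f p phi) H // add0r.
by apply: (IH (fun y a b => phi y (ccons f a) b)) => y a b s; apply: H => /=; lia.
Qed.

Lemma sum_splits_nil x z (p : chain E x z)
    (phi : forall y, chain E x y -> chain E y z -> V) :
  (forall y y' (f : E x y) (a : chain E y y') b, phi _ (ccons f a) b = 0) ->
  \sum_(s <- splits p) phi _ (cfst s) (csnd s) = phi _ (cnil x) p.
Proof.
case: p phi => [x0|x0 y0 z0 f p] phi phi0; first by rewrite /= big_seq1.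
by rewrite (sum_splitsS f p phi) big1 ?addr0.
Qed.

Lemma sum_splits_nilr x z (p : chain E x z)
    (phi : forall y, chain E x y -> chain E y z -> V) :
  (forall y y' (f : E y y') (a : chain E x y) b, phi _ a (ccons f b) = 0) ->
  \sum_(s <- splits p) phi _ (cfst s) (csnd s) = phi _ p (cnil z).
Proof.
elim: p phi => [x0|x0 y0 z0 f p IH] phi phi0; first by rewrite /= big_seq1.
rewrite (sum_splitsS f p phi) phi0 add0r.
by apply: (IH (fun y a b => phi y (ccons f a) b)) => *; apply: phi0.
Qed.

Definition nil_front y z (q : chain (chain E) y z) :
    forall x t u, E x y -> chain E z t -> chain (chain E) t u ->
      seq (chain (chain E) x u) :=
  match q in chain _ y z return
    forall x t u, E x y -> chain E z t -> chain (chain E) t u ->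
      seq (chain (chain E) x u)
  with
  | cnil _ => fun _ _ _ f X r => [:: ccons (ccons f X) r]
  | ccons _ _ _ _ _ => fun _ _ _ _ _ _ => [::]
  end.

Lemma sum_first_block_cat x y z t u (f : E x y) (q : chain (chain E) y z)
    (X : chain E z t) (r : chain (chain E) t u)
    (phi : chain (chain E) x u -> V) :
  \sum_(q' <- first_block_cons (ccat q (ccons X r)) f) phi q' =
  \sum_(q' <- nil_front q f X r) phi q' +
  \sum_(q' <- first_block_cons q f) phi (ccat q' (ccons X r)).
Proof.
by case: q X f => [?|? ? ? b q] X f; rewrite /= !(big_nil, big_seq1) ?addr0 ?add0r.
Qed.

Lemma sum_first_block_nil x y z (f : E x y) (q : chain (chain E) y z)
    (phi : chain (chain E) x z -> V) :
  (forall y' (b : chain E x y') q', phi (ccons b q') = 0) ->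
  \sum_(q' <- first_block_cons q f) phi q' = 0.
Proof.
by case: q f phi => [?|? ? ? b q] f phi H; rewrite /= (big_nil, big_seq1).
Qed.

Lemma sum_blocks_nil x y z (f : E x y) (p : chain E y z)
    (phi : chain (chain E) x z -> V) :
  (forall y' (b : chain E x y') q', phi (ccons b q') = 0) ->
  \sum_(q <- blocks (ccons f p)) phi q = 0.
Proof.
move=> H; rewrite sum_blocksS big1 // => q _.
by rewrite H sum_first_block_nil ?addr0.
Qed.

Lemma sum_blocks_mid x y z t (a : chain E x y) (e : E y z) (c : chain E z t)
    (phi : chain (chain E) x t -> V) :
  \sum_(q <- blocks (ccat a (ccons e c))) phi q =
  \sum_(s <- splits a) \sum_(u <- splits c)
    \sum_(q1 <- blocks (cfst s)) \sum_(q2 <- blocks (csnd u))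
      phi (ccat q1 (ccons (ccat (csnd s) (ccons e (cfst u))) q2)).
Proof.
elim: a e phi => [x0|x0 y0 z0 f a IH] e phi.
  rewrite sum_blocks_head /= big_seq1 /=; apply: eq_bigr => u _.
  by rewrite big_seq1.
rewrite [ccat _ _]/= (sum_blocksS f) IH.
rewrite (sum_splitsS f a (fun y a1 a2 => \sum_(u <- splits c)
  \sum_(q1 <- blocks a1) \sum_(q2 <- blocks (csnd u))
      phi (ccat q1 (ccons (ccat a2 (ccons e (cfst u))) q2)))).
pose chi y1 (a1 : chain E y0 y1) (a2 : chain E y1 z0) :=
  \sum_(u <- splits c) \sum_(q1 <- blocks a1) \sum_(q2 <- blocks (csnd u))
  \sum_(q' <- nil_front q1 f (ccat a2 (ccons e (cfst u))) q2) phi q'.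
have chiE : \sum_(s <- splits a) chi _ (cfst s) (csnd s) = chi _ (cnil y0) a.
  apply: sum_splits_nil => y1 y2 f' a1 a2; apply: big1 => u _.
  apply: sum_blocks_nil => y' b q'; apply: big1 => q2 _.
  by rewrite /= big_nil.
rewrite /chi /= in chiE.
under [LHS]eq_bigr => s _.
  under eq_bigr => u _.
    under eq_bigr => q1 _.
      under eq_bigr => q2 _ do rewrite sum_first_block_cat addrCA /=.
      rewrite big_split /=; over.
    rewrite big_split /=; over.
  rewrite big_split /=; over.
rewrite big_split /= {}chiE; congr (_ + _).
  apply: eq_bigr => u _; rewrite /= !big_seq1.
  by apply: eq_bigr => q2 _; rewrite big_seq1.
apply: eq_bigr => s _; apply: eq_bigr => u _; rewrite sum_blocksS.
by apply: eq_bigr => q1 _; rewrite big_split exchange_big.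
Qed.

End BlockSums2.

Arguments sum_splits_eq0 {O E V x z p} phi.
Arguments sum_splits_nil {O E V x z p} phi.
Arguments sum_splits_nilr {O E V x z p} phi.
Arguments sum_blocks_nil {O E V x y z f p} phi.

Section ChainMaps.

Lemma csize_chmap (O1 O2 : Type) (E1 : O1 -> O1 -> Type)
    (E2 : O2 -> O2 -> Type) (phi : O1 -> O2)
    (h : forall x y, E1 x y -> E2 (phi x) (phi y)) x z (p : chain E1 x z) :
  csize (chmap h p) = csize p.
Proof. by elim: p => //= ? ? ? f p ->. Qed.

Lemma chmap_cat (O1 O2 : Type) (E1 : O1 -> O1 -> Type)
    (E2 : O2 -> O2 -> Type) (phi : O1 -> O2)
    (h : forall x y, E1 x y -> E2 (phi x) (phi y)) x y z
    (p : chain E1 x y) (q : chain E1 y z) :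
  chmap h (ccat p q) = ccat (chmap h p) (chmap h q).
Proof. by elim: p q => //= ? ? ? f p IH q; rewrite IH. Qed.

Lemma chmap_comp (O1 O2 O3 : Type) (E1 : O1 -> O1 -> Type)
    (E2 : O2 -> O2 -> Type) (E3 : O3 -> O3 -> Type)
    (phi : O1 -> O2) (psi : O2 -> O3)
    (h : forall x y, E1 x y -> E2 (phi x) (phi y))
    (k : forall x y, E2 x y -> E3 (psi x) (psi y)) x z (p : chain E1 x z) :
  chmap k (chmap h p) =
  chmap (phi := fun x => psi (phi x)) (fun _ _ f => k _ _ (h _ _ f)) p.
Proof. by elim: p => //= ? ? ? f p ->. Qed.

Lemma blocks_chmap (O1 O2 : Type) (E1 : O1 -> O1 -> Type)
    (E2 : O2 -> O2 -> Type) (phi : O1 -> O2)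
    (h : forall x y, E1 x y -> E2 (phi x) (phi y)) x z (p : chain E1 x z) :
  blocks (chmap h p) =
  [seq chmap (fun _ _ b => chmap h b) q | q <- blocks p].
Proof.
elim: p => //= x0 y0 z0 f p ->; rewrite map_flatten -!map_comp; congr flatten.
by apply: eq_map => q /=; congr (_ :: _); case: q f.
Qed.

Lemma sum_splits_chmap (V : nmodType) (O1 O2 : Type) (E1 : O1 -> O1 -> Type)
    (E2 : O2 -> O2 -> Type) (phi : O1 -> O2)
    (h : forall x y, E1 x y -> E2 (phi x) (phi y)) x z (p : chain E1 x z)
    (psi : forall y, chain E2 (phi x) y -> chain E2 y (phi z) -> V) :
  \sum_(s <- splits (chmap h p)) psi _ (cfst s) (csnd s) =
  \sum_(s <- splits p) psi _ (chmap h (cfst s)) (chmap h (csnd s)).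
Proof.
elim: p psi => [x0|x0 y0 z0 f p IH] psi; first by rewrite /= !big_seq1.
rewrite (sum_splitsS (h _ _ f) (chmap h p) psi).
rewrite (sum_splitsS f p (fun _ a b => psi _ (chmap h a) (chmap h b))).
by rewrite (IH (fun _ a b => psi _ (ccons (h _ _ f) a) b)).
Qed.

Lemma sum_blocks_csize (V : nmodType) (O : Type) (E : O -> O -> Type) x z
    (p : chain E x z) (psi : bool -> chain (chain E) x z -> V) :
  \sum_(q <- blocks p) psi (csize q == 0) q =
  \sum_(q <- blocks p) psi (csize p == 0) q.
Proof.
case: p psi => [x0|x0 y0 z0 f p] psi; first by rewrite /= !big_seq1.
rewrite !sum_blocksS /=; apply: eq_bigr => q _; congr (_ + _).
move: (csize p) => n {p}.
by case: q f psi => [?|? ? ? b q] f psi; rewrite /= !(big_nil, big_seq1).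
Qed.

End ChainMaps.

Section Graded.
Variable R : comPzRingType.

Definition sg (k : int) : R := (-1) ^+ absz k.

(* A graded module is the direct sum of its homogeneous parts; it is given by *)
(* the projections v |-> v_d, and its part of degree d is {v | v_d = v}.      *)
Record gmod := GMod {
  gcar :> lmodType R;
  gcomp : int -> {linear gcar -> gcar};
  gcompK : forall d e v, gcomp d (gcomp e v) = if d == e then gcomp e v else 0;
  gcomp_fin : forall v, exists2 s : seq int, uniq s & v = \sum_(d <- s) gcomp d v
}.

Definition homog (M : gmod) (d : int) (v : M) : Prop := gcomp M d v = v.

Record gquiver := GQuiver { qob :> Type; qhom : qob -> qob -> gmod }.

Definition arr (Q : gquiver) (x y : Q) : Type := qhom x y.

Record harr (Q : gquiver) (x y : Q) := HArr {
  hdeg : int; hval : qhom x y; hvalP : homog hdeg hval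
}.

Definition cval (Q : gquiver) (x z : Q) (p : chain (@harr Q) x z) :
    chain (@arr Q) x z :=
  chmap (phi := id) (@hval Q) p.

(* For p = (f_1, ..., f_n), this is deg f_1 + ... + deg f_n - n; an operation *)
(* with values in Hom[k - n] sends (f_n, ..., f_1) to degree rdeg p + k.      *)
Fixpoint rdeg (Q : gquiver) (x z : Q) (p : chain (@harr Q) x z) : int :=
  if p is ccons _ _ _ f p' then hdeg f - 1 + rdeg p' else 0.

Definition multilinear (Q : gquiver) (W : Q -> Q -> lmodType R)
    (mu : forall x z, chain (@arr Q) x z -> W x z) : Prop :=
  forall x y z t (p : chain (@arr Q) x y) (a : R) (f g : qhom y z)
      (q : chain (@arr Q) z t),
    mu _ _ (ccat p (ccons (a *: f + g : arr _ _) q)) =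
    a *: mu _ _ (ccat p (ccons (f : arr _ _) q)) +
    mu _ _ (ccat p (ccons (g : arr _ _) q)).

(* The sum over m >= 1 and k of (-1)^(deg f_1 + ... + deg f_k - k) times      *)
(* mu (f_n, ..., m (f_(k+m), ..., f_(k+1)), f_k, ..., f_1).                   *)
Definition insertion_sum (Q : gquiver)
    (m : forall x z, chain (@arr Q) x z -> arr x z)
    (W : Q -> Q -> lmodType R) (mu : forall x z, chain (@arr Q) x z -> W x z)
    x z (p : chain (@harr Q) x z) : W x z :=
  \sum_(s <- splits p) \sum_(t <- splits (csnd s) | (0 < csize (cfst t))%N)
    sg (rdeg (cfst s)) *:
      mu _ _ (ccat (cval (cfst s))
               (ccons (m _ _ (cval (cfst t))) (cval (csnd t)))).

(* The operation m^n is m on chains of length n >= 1; on empty chains, where  *)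
(* there is no operation, m is set to 0; similarly for functors below.        *)
Record is_ainf_cat (Q : gquiver)
    (m : forall x z, chain (@arr Q) x z -> arr x z)
    (one : forall x : Q, arr x x) : Prop := IsAinfCat {
  m_nil : forall x, m _ _ (cnil x) = 0 :> qhom x x;
  m_linear : multilinear (W := @qhom Q) m;
  m_homog : forall x z (p : chain (@harr Q) x z),
    homog (M := qhom x z) (rdeg p + 2) (m _ _ (cval p));
  m_rel : forall x z (p : chain (@harr Q) x z),
    insertion_sum m (W := @qhom Q) m p = 0;
  one_homog : forall x, homog (M := qhom x x) 0 (one x);
  one_closed : forall x, m _ _ (chain1 (one x)) = 0 :> qhom x x;
  one_source : forall x y (f : arr x y), m _ _ (ccons (one x) (chain1 f)) = f;
  one_target : forall x y (f : harr x y),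
    hval f = sg (hdeg f) *: (m _ _ (ccons (hval f : arr _ _) (chain1 (one y)))
                             : qhom x y);
  m_one : forall x y z (p : chain (@arr Q) x y) (q : chain (@arr Q) y z),
    (2 <= csize p + csize q)%N ->
    m _ _ (ccat p (ccons (one y) q)) = 0 :> qhom x z
}.

Record ainfCat := AinfCat {
  aquiver :> gquiver;
  am : forall x z : aquiver, chain (@arr aquiver) x z -> arr x z;
  aone : forall x : aquiver, arr x x;
  ainfCatP : is_ainf_cat am aone
}.

Record is_ainf_functor (A B : ainfCat) (F0 : A -> B)
    (F : forall x z, chain (@arr A) x z -> arr (F0 x) (F0 z)) : Prop :=
  IsAinfFunctor {
  fun_nil : forall x, F _ _ (cnil x) = 0 :> qhom (F0 x) (F0 x);
  fun_linear : multilinear (W := fun x z => qhom (F0 x) (F0 z)) F;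
  fun_homog : forall x z (p : chain (@harr A) x z),
    homog (M := qhom (F0 x) (F0 z)) (rdeg p + 1) (F _ _ (cval p));
  fun_rel : forall x z (p : chain (@harr A) x z),
    \sum_(q <- blocks (cval p)) (am (chmap F q) : qhom (F0 x) (F0 z)) =
    insertion_sum (@am A) (W := fun x z => qhom (F0 x) (F0 z)) F p;
  fun_one : forall x, F _ _ (chain1 (aone x)) = aone (F0 x);
  fun_ones : forall x y z (p : chain (@arr A) x y) (q : chain (@arr A) y z),
    (1 <= csize p + csize q)%N ->
    F _ _ (ccat p (ccons (aone y) q)) = 0 :> qhom (F0 x) (F0 z)
}.

Record ainfFun (A B : ainfCat) := AinfFun {
  fob :> A -> B;
  fmor : forall x z, chain (@arr A) x z -> arr (fob x) (fob z);
  ainfFunP : is_ainf_functor fmor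
}.

Lemma sgD (a b : int) : sg (a + b) = sg a * sg b.
Proof.
rewrite /sg -[LHS]signr_odd -[X in X * _]signr_odd -[X in _ * X]signr_odd.
rewrite -signr_addb; congr (_ ^+ nat_of_bool _); lia.
Qed.

Lemma homog_sum (M : gmod) d (I : Type) (r : seq I) (F : I -> M) :
  (forall i, homog d (F i)) -> homog d (\sum_(i <- r) F i).
Proof. by move=> H; rewrite /homog linear_sum; apply: eq_bigr => i _; apply: H. Qed.

Lemma homog0 (M : gmod) d : homog d (0 : M).
Proof. exact: linear0. Qed.

Section Multilinear.
Variables (Q : gquiver) (W : Q -> Q -> lmodType R).
Variable mu : forall x z, chain (@arr Q) x z -> W x z.
Hypothesis muL : multilinear mu.

Lemma multilinear0 x y z t (p : chain (@arr Q) x y) (q : chain (@arr Q) z t) :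
  mu (ccat p (ccons (0 : qhom y z) q)) = 0.
Proof.
have := muL p 1 (0 : qhom y z) 0 q; rewrite !scale1r addr0 => /eqP.
by rewrite -subr_eq0 opprD addrA subrr sub0r oppr_eq0 => /eqP.
Qed.

Lemma multilinearD x y z t (p : chain (@arr Q) x y) (f g : qhom y z)
    (q : chain (@arr Q) z t) :
  mu (ccat p (ccons (f + g : arr _ _) q)) =
  mu (ccat p (ccons (f : arr _ _) q)) + mu (ccat p (ccons (g : arr _ _) q)).
Proof. by have := muL p 1 f g q; rewrite !scale1r. Qed.

Lemma multilinearZ x y z t (p : chain (@arr Q) x y) a (f : qhom y z)
    (q : chain (@arr Q) z t) :
  mu (ccat p (ccons (a *: f : arr _ _) q)) = a *: mu (ccat p (ccons (f : arr _ _) q)).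
Proof. by have := muL p a f 0 q; rewrite addr0 multilinear0 addr0. Qed.

Lemma multilinear_sum x y z t (p : chain (@arr Q) x y) (I : Type) (r : seq I)
    (P : pred I) (f : I -> qhom y z) (q : chain (@arr Q) z t) :
  mu (ccat p (ccons (\sum_(i <- r | P i) f i : arr _ _) q)) =
  \sum_(i <- r | P i) mu (ccat p (ccons (f i : arr _ _) q)).
Proof.
by apply: (big_morph (fun e : qhom y z => mu (ccat p (ccons (e : arr _ _) q))))
  => [e e'|]; [exact: multilinearD | exact: multilinear0].
Qed.

Lemma multilinear_choices (O : Type) (phi : O -> Q) (D D' : O -> O -> Type)
    (c : forall x y, D x y -> seq (D' x y))
    (h : forall x y, D' x y -> qhom (phi x) (phi y))
    w x z (r : chain (@arr Q) w (phi x)) (q : chain D x z) :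
  mu (ccat r (chmap (E2 := @arr Q) (phi := phi)
     (fun x y e => \sum_(e' <- c x y e) h _ _ e') q)) =
  \sum_(q' <- choices c q) mu (ccat r (chmap (E2 := @arr Q) h q')).
Proof.
elim: q r => [x0|x0 y0 z0 e q IH] r; first by rewrite /= big_seq1.
rewrite sum_choicesS /= multilinear_sum; apply: eq_bigr => e' _.
have E u (s : chain (@arr Q) (phi y0) u) :
    ccat r (ccons (h _ _ e' : arr _ _) s) =
    ccat (ccat r (chain1 (h _ _ e' : arr _ _))) s by rewrite -ccatA.
by rewrite E IH; apply: eq_bigr => q' _; rewrite -E.
Qed.

End Multilinear.

Lemma rdeg_cat (Q : gquiver) (x y z : Q) (p : chain (@harr Q) x y)
    (q : chain (@harr Q) y z) : rdeg (ccat p q) = rdeg p + rdeg q.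
Proof. by elim: p q => [?|? ? ? f p IH] q; rewrite /= ?add0r // IH addrA. Qed.

Lemma sum_splits_rdeg (V : nmodType) (Q : gquiver) (x z : Q)
    (p : chain (@harr Q) x z)
    (psi : int -> forall y, chain (@harr Q) x y -> chain (@harr Q) y z -> V) :
  \sum_(s <- splits p) psi (rdeg p) _ (cfst s) (csnd s) =
  \sum_(s <- splits p) psi (rdeg (cfst s) + rdeg (csnd s)) _ (cfst s) (csnd s).
Proof.
elim: p psi => [x0|x0 y0 z0 f p IH] psi; first by rewrite /= !big_seq1.
rewrite (sum_splitsS f p (psi _)).
rewrite (sum_splitsS f p (fun y a b => psi (rdeg a + rdeg b) y a b)) /= add0r.
congr (_ + _); rewrite (IH (fun k y a b => psi (hdeg f - 1 + k) _ (ccons f a) b)).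
by apply: eq_bigr => s _; apply: (congr1 (fun k => psi k _ _ _)); rewrite /= addrA.
Qed.

(* Total reduced degree of a chain of blocks. *)
Fixpoint brdeg (Q : gquiver) (x z : Q) (q : chain (chain (@harr Q)) x z) : int :=
  if q is ccons _ _ _ b q' then rdeg b + brdeg q' else 0.

Lemma sum_blocks_brdeg (V : nmodType) (Q : gquiver) (x z : Q)
    (p : chain (@harr Q) x z) (psi : int -> chain (chain (@harr Q)) x z -> V) :
  \sum_(q <- blocks p) psi (brdeg q) q = \sum_(q <- blocks p) psi (rdeg p) q.
Proof.
elim: p psi => [x0|x0 y0 z0 f p IH] psi; first by rewrite /= !big_seq1.
rewrite !sum_blocksS [rdeg _]/=.
rewrite -(IH (fun k q => psi (hdeg f - 1 + k) (ccons (chain1 f) q) +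
  \sum_(q' <- first_block_cons q f) psi (hdeg f - 1 + k) q')).
apply: eq_bigr => q _; rewrite /= addr0; congr (_ + _).
case: q f psi {IH p} => [?|? ? ? b q] f psi; rewrite /= ?big_nil // !big_seq1 /=.
by rewrite addrA.
Qed.

Lemma insertion_sumE (Q : gquiver)
    (m : forall x z, chain (@arr Q) x z -> arr x z)
    (W : Q -> Q -> lmodType R) (mu : forall x z, chain (@arr Q) x z -> W x z)
    x z (p : chain (@harr Q) x z) :
  multilinear mu -> (forall x, m _ _ (cnil x) = 0 :> qhom x x) ->
  insertion_sum m mu p =
  \sum_(s <- splits p) \sum_(t <- splits (csnd s))
    sg (rdeg (cfst s)) *:
      mu _ _ (ccat (cval (cfst s))
               (ccons (m _ _ (cval (cfst t))) (cval (csnd t)))).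
Proof.
move=> muL m0; apply: eq_bigr => -[y1 p1 p2] _ /=; rewrite [RHS](bigID (fun t => 0 < csize (cfst t))%N) /=.
rewrite [X in _ = _ + X]big1 ?addr0 // => -[y a b] /=.
by case: a b p1 {p2} => [?|//] b p1 _ /=; rewrite m0 multilinear0 // scaler0.
Qed.

Section FunctorValue.
Variables (A B : ainfCat) (F : ainfFun A B).

(* F applied to a homogeneous chain is homogeneous. *)
Definition fharr x z (p : chain (@harr A) x z) : harr (F x) (F z) :=
  HArr (fun_homog (ainfFunP F) p).

Lemma rdeg_chmap x z (q : chain (chain (@harr A)) x z) :
  rdeg (chmap fharr q) = brdeg q.
Proof. by elim: q => //= ? ? ? b q ->; rewrite addrK. Qed.

Lemma cval_chmap x z (q : chain (chain (@harr A)) x z) :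
  cval (chmap fharr q) = chmap (fun _ _ b => fmor F (cval b)) q.
Proof. by rewrite /cval; elim: q => //= ? ? ? b q ->. Qed.

Lemma chmap_fmor_cval x z (q : chain (chain (@harr A)) x z) :
  chmap (@fmor _ _ F) (chmap (phi := id) (@cval A) q) =
  chmap (fun _ _ b => fmor F (cval b)) q.
Proof. by rewrite /cval; elim: q => //= ? ? ? b q ->. Qed.

Lemma blocks_cval x z (p : chain (@harr A) x z) :
  blocks (cval p) = [seq chmap (phi := id) (@cval A) q | q <- blocks p].
Proof. exact: blocks_chmap. Qed.

End FunctorValue.

Section Composition.
Variables (A B C : ainfCat) (G : ainfFun B C) (F : ainfFun A B).

Definition comp_fob (x : A) : C := G (F x).

Definition comp_fmor x z (p : chain (@arr A) x z) :
    arr (comp_fob x) (comp_fob z) :=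
  \sum_(q <- blocks p) (fmor G (chmap (@fmor _ _ F) q) : qhom _ _).

Let GL := fun_linear (ainfFunP G).
Let FL := fun_linear (ainfFunP F).

Lemma comp_mid x y z t (a : chain (@arr A) x y) (e : arr y z)
    (c : chain (@arr A) z t) :
  comp_fmor (ccat a (ccons e c)) =
  \sum_(s <- splits a) \sum_(u <- splits c)
    \sum_(q1 <- blocks (cfst s)) \sum_(q2 <- blocks (csnd u))
     (fmor G (ccat (chmap (@fmor _ _ F) q1)
       (ccons (fmor F (ccat (csnd s) (ccons e (cfst u))))
          (chmap (@fmor _ _ F) q2))) : qhom _ _).
Proof.
rewrite /comp_fmor (sum_blocks_mid a e c (fun q => fmor G (chmap (@fmor _ _ F) q) : qhom _ _)).
do 4![apply: eq_bigr => ? _]; by rewrite chmap_cat.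
Qed.

Let Fh x z (q : chain (chain (@harr A)) x z) : chain (@arr B) (F x) (F z) :=
  chmap (fun _ _ b => fmor F (cval b)) q.

Lemma comp_mid_cval x y z t (a : chain (@harr A) x y) (e : arr y z)
    (c : chain (@harr A) z t) :
  comp_fmor (ccat (cval a) (ccons e (cval c))) =
  \sum_(s <- splits a) \sum_(u <- splits c)
    \sum_(q1 <- blocks (cfst s)) \sum_(q2 <- blocks (csnd u))
     (fmor G (ccat (Fh q1)
       (ccons (fmor F (ccat (cval (csnd s)) (ccons e (cval (cfst u)))))
          (Fh q2))) : qhom _ _).
Proof.
rewrite comp_mid (sum_splits_chmap (phi := id) (@hval A) a (fun y a1 a2 =>
  \sum_(u <- splits (cval c)) \sum_(q1 <- blocks a1) \sum_(q2 <- blocks (csnd u))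
     (fmor G (ccat (chmap (@fmor _ _ F) q1)
       (ccons (fmor F (ccat a2 (ccons e (cfst u))))
          (chmap (@fmor _ _ F) q2))) : qhom _ _))).
apply: eq_bigr => s _.
rewrite (sum_splits_chmap (phi := id) (@hval A) c (fun y c1 c2 =>
  \sum_(q1 <- blocks (cval (cfst s))) \sum_(q2 <- blocks c2)
     (fmor G (ccat (chmap (@fmor _ _ F) q1)
       (ccons (fmor F (ccat (cval (csnd s)) (ccons e c1)))
          (chmap (@fmor _ _ F) q2))) : qhom _ _))).
apply: eq_bigr => u _; rewrite !blocks_cval big_map; apply: eq_bigr => q1 _.
by rewrite big_map; apply: eq_bigr => q2 _; rewrite !chmap_fmor_cval.
Qed.

Lemma fun_rel_cval x z (p : chain (@harr A) x z) :
  \sum_(q <- blocks p) (am (Fh q) : qhom (F x) (F z)) =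
  \sum_(s <- splits p) \sum_(t <- splits (csnd s))
    sg (rdeg (cfst s)) *:
      (fmor F (ccat (cval (cfst s))
               (ccons (am (cval (cfst t))) (cval (csnd t)))) : qhom _ _).
Proof.
rewrite -insertion_sumE //; last by move=> y; apply: m_nil (ainfCatP A) _.
rewrite -(fun_rel (ainfFunP F)) blocks_cval big_map.
by apply: eq_bigr => q _; rewrite chmap_fmor_cval.
Qed.

Lemma comp_linear :
  multilinear (W := fun x z => qhom (comp_fob x) (comp_fob z)) comp_fmor.
Proof.
move=> x y z t p a f g q; rewrite !comp_mid.
do 4![rewrite scaler_sumr -big_split /=; apply: eq_bigr => ? _].
by rewrite FL GL.
Qed.

Lemma comp_rel x z (p : chain (@harr A) x z) :
  \sum_(q <- blocks (cval p))
     (am (chmap comp_fmor q) : qhom (comp_fob x) (comp_fob z)) =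
  insertion_sum (@am A) (W := fun x z => qhom (comp_fob x) (comp_fob z))
    comp_fmor p.
Proof.
have mL := m_linear (ainfCatP C).
have H q := multilinear_choices mL (phi := comp_fob) (@blocks A (@arr A))
  (fun x y q => fmor G (chmap (@fmor _ _ F) q)) (cnil (comp_fob x)) (q : chain (chain (@arr A)) x z).
under eq_bigr => q _ do rewrite [am _]H /=.
rewrite -(sum_blocks_blocks (cval p) (fun Q => am (chmap (phi := comp_fob)
  (fun x0 y0 e' => fmor G (chmap (@fmor _ _ F) e')) Q) : qhom _ _)) {H}.
transitivity (\sum_(q <- blocks p) (insertion_sum (@am B)
   (W := fun x z => qhom (G x) (G z)) (@fmor _ _ G) (chmap (fharr F) q))).
  rewrite blocks_cval big_map; apply: eq_bigr => q _.
  rewrite -(fun_rel (ainfFunP G)) cval_chmap -chmap_fmor_cval.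
  rewrite (blocks_chmap (@fmor _ _ F)) big_map; apply: eq_bigr => Q _.
  by rewrite chmap_comp.
have GE x' z' (q : chain (chain (@harr A)) x' z') :
  insertion_sum (@am B) (W := fun x z => qhom (G x) (G z)) (@fmor _ _ G)
     (chmap (fharr F) q) =
  \sum_(s <- splits q) \sum_(t <- splits (csnd s))
    sg (brdeg (cfst s)) *: (fmor G (ccat (Fh (cfst s))
      (ccons (am (Fh (cfst t)))
             (Fh (csnd t)))) : qhom _ _).
  rewrite insertion_sumE //; last by move=> y; apply: m_nil (ainfCatP B) _.
  rewrite (sum_splits_chmap (fharr F) q (fun y a b => \sum_(t <- splits b)
    sg (rdeg a) *: (fmor G (ccat (cval a)
      (ccons (am (cval (cfst t))) (cval (csnd t)))) : qhom _ _))).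
  apply: eq_bigr => s _.
  rewrite (sum_splits_chmap (fharr F) (csnd s) (fun y a b =>
    sg (rdeg (chmap (fharr F) (cfst s))) *: (fmor G (ccat (cval (chmap (fharr F) (cfst s)))
      (ccons (am (cval a)) (cval b))) : qhom _ _))).
  by apply: eq_bigr => t _; rewrite rdeg_chmap !cval_chmap.
under eq_bigr => q _ do rewrite GE.
rewrite {GE} (sum_blocks_splits p (fun y a b => \sum_(t <- splits b)
    sg (brdeg a) *: (fmor G (ccat (Fh a)
      (ccons (am (Fh (cfst t)))
             (Fh (csnd t)))) : qhom _ _))).
pose K y1 y2 y3 y4 (p1 : chain (@harr A) x y1) (a : chain (@harr A) y1 y2)
    (b : chain (@harr A) y2 y3) (c : chain (@harr A) y3 y4)
    (p3 : chain (@harr A) y4 z) : qhom (comp_fob x) (comp_fob z) :=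
  \sum_(q1 <- blocks p1) \sum_(q3 <- blocks p3)
    sg (rdeg p1 + rdeg a) *:
     (fmor G (ccat (Fh q1)
       (ccons (fmor F (ccat (cval a) (ccons (am (cval b)) (cval c))))
          (Fh q3))) : qhom (comp_fob x) (comp_fob z)).
transitivity (\sum_(s <- splits p) \sum_(t <- splits (csnd s))
   \sum_(u <- splits (cfst t)) \sum_(v <- splits (csnd u))
     K _ _ _ _ (cfst s) (cfst u) (cfst v) (csnd v) (csnd t)).
  apply: eq_bigr => s _.
  rewrite (sum_blocks_brdeg (cfst s) (fun k q1 =>
    \sum_(q2 <- blocks (csnd s)) \sum_(t <- splits q2) sg k *:
      (fmor G (ccat (Fh q1) (ccons (am (Fh (cfst t))) (Fh (csnd t)))) : qhom (comp_fob x) (comp_fob z)))).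
  under eq_bigr => q1 _ do rewrite (sum_blocks_splits (csnd s) (fun y a b =>
    sg (rdeg (cfst s)) *:
      (fmor G (ccat (Fh q1) (ccons (am (Fh a)) (Fh b))) : qhom (comp_fob x) (comp_fob z)))).
  rewrite exchange_big; apply: eq_bigr => t _ /=.
  transitivity (\sum_(q1 <- blocks (cfst s)) \sum_(q3 <- blocks (csnd t))
    \sum_(u <- splits (cfst t)) \sum_(v <- splits (csnd u))
    sg (rdeg (cfst s) + rdeg (cfst u)) *:
     (fmor G (ccat (Fh q1)
       (ccons (fmor F (ccat (cval (cfst u)) (ccons (am (cval (cfst v))) (cval (csnd v)))))
          (Fh q3))) : qhom (comp_fob x) (comp_fob z))).
    apply: eq_bigr => q1 _; rewrite exchange_big; apply: eq_bigr => q3 _ /=.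
    rewrite -scaler_sumr -(multilinear_sum GL) fun_rel_cval (multilinear_sum GL) scaler_sumr.
    apply: eq_bigr => u _; rewrite (multilinear_sum GL) scaler_sumr.
    by apply: eq_bigr => v _; rewrite (multilinearZ GL) scalerA sgD.
  rewrite /K; under [LHS]eq_bigr => q1 _ do rewrite exchange_big /=.
  rewrite [LHS]exchange_big /=; apply: eq_bigr => u _.
  under [LHS]eq_bigr => q1 _ do rewrite exchange_big /=.
  by rewrite [LHS]exchange_big.
rewrite insertion_sumE; [|exact: comp_linear|exact: m_nil (ainfCatP A)].
transitivity (\sum_(s <- splits p) \sum_(t <- splits (cfst s))
   \sum_(u <- splits (csnd s)) \sum_(v <- splits (csnd u))
     K _ _ _ _ (cfst t) (csnd t) (cfst u) (cfst v) (csnd v)).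
  rewrite (splitsA p (fun _ _ p1 a w =>  \sum_(u <- splits w)
    \sum_(v <- splits (csnd u)) K _ _ _ _ p1 a (cfst u) (cfst v) (csnd v))).
  apply: eq_bigr => s _.
  rewrite (splitsA (csnd s) (fun _ _ a y p3 => \sum_(v <- splits y)
     K _ _ _ _ (cfst s) a (cfst v) (csnd v) p3)).
  apply: eq_bigr => t _.
  by rewrite (splitsA (csnd t) (fun _ _ b c p3 => K _ _ _ _ (cfst s) (cfst t) b c p3)).
apply: eq_bigr => s _; rewrite exchange_big; apply: eq_bigr => u _ /=.
rewrite comp_mid_cval scaler_sumr.
rewrite (sum_splits_rdeg (cfst s) (fun k _ p1 a => sg k *: \sum_(v <- splits (csnd u))
   \sum_(q1 <- blocks p1) \sum_(q2 <- blocks (csnd v))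
     (fmor G (ccat (Fh q1)
       (ccons (fmor F (ccat (cval a) (ccons (am (cval (cfst u))) (cval (cfst v)))))
          (Fh q2))) : qhom (comp_fob x) (comp_fob z)))).
apply: eq_bigr => t _; rewrite scaler_sumr; apply: eq_bigr => v _.
rewrite scaler_sumr; apply: eq_bigr => q1 _.
by rewrite scaler_sumr.
Qed.

End Composition.
Section ComposedFunctor.
Variables (A B C : ainfCat) (G : ainfFun B C) (F : ainfFun A B).

Let GL := fun_linear (ainfFunP G).

Lemma comp_homog x z (p : chain (@harr A) x z) :
  homog (M := qhom (comp_fob G F x) (comp_fob G F z)) (rdeg p + 1)
    (comp_fmor G F (cval p)).
Proof.
rewrite /homog /comp_fmor blocks_cval big_map linear_sum.
rewrite -(sum_blocks_brdeg p (fun k q => gcomp (qhom (G (F x)) (G (F z))) (k + 1)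
  (fmor G (chmap (@fmor _ _ F) (chmap (phi := id) (@cval A) q))))).
apply: eq_bigr => q _; rewrite chmap_fmor_cval -cval_chmap -(rdeg_chmap F).
exact: fun_homog (ainfFunP G) _ _ _.
Qed.

Lemma comp_ones x y z (p : chain (@arr A) x y) (q : chain (@arr A) y z) :
  (1 <= csize p + csize q)%N ->
  comp_fmor G F (ccat p (ccons (aone y) q)) =
  0 :> qhom (comp_fob G F x) (comp_fob G F z).
Proof.
move=> pq; rewrite comp_mid.
apply: (sum_splits_eq0 (fun y1 p1 p2 => \sum_(u <- splits q)
    \sum_(q1 <- blocks p1) \sum_(q2 <- blocks (csnd u))
     (fmor G (ccat (chmap (@fmor _ _ F) q1)
       (ccons (fmor F (ccat p2 (ccons (aone y) (cfst u))))
          (chmap (@fmor _ _ F) q2))) : qhom (G (F x)) (G (F z))))) => y1 p1 p2 sp.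
apply: (sum_splits_eq0 (fun y1 c1 c2 =>
    \sum_(q1 <- blocks p1) \sum_(q2 <- blocks c2)
     (fmor G (ccat (chmap (@fmor _ _ F) q1)
       (ccons (fmor F (ccat p2 (ccons (aone y) c1)))
          (chmap (@fmor _ _ F) q2))) : qhom (G (F x)) (G (F z))))) => y2 c1 c2 sq.
have [big|small] := leqP 1 (csize p2 + csize c1).
  do 2![apply: big1 => ? _]; rewrite (fun_ones (ainfFunP F)) //.
  exact: multilinear0 GL _ _ _ _ _ _.
have tot : (1 <= csize p1 + csize p2 + csize c1 + csize c2)%N by lia.
clear pq sp sq.
case: p2 c1 p1 small tot {p q} => [y3|//] c1.
case: c1 c2 => [y4|? ? ? ? ?] c2 p1; last by rewrite /=; lia.
move=> _ tot /=.
rewrite (fun_one (ainfFunP F)).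
pose tm b1 b2 q1 q2 : qhom (G (F x)) (G (F z)) := if b1 && b2 then
  fmor G (ccat (chmap (@fmor _ _ F) q1) (ccons (aone (F y4))
    (chmap (@fmor _ _ F) q2))) else 0.
transitivity (\sum_(q1 <- blocks p1) \sum_(q2 <- blocks c2)
    tm (csize q1 == 0)%N (csize q2 == 0)%N q1 q2).
  do 2![apply: eq_bigr => ? _]; rewrite /tm; case: ifP => // n0.
  by rewrite (fun_ones (ainfFunP G)) // !csize_chmap; lia.
rewrite (sum_blocks_csize p1 (fun b q1 => \sum_(q2 <- blocks c2) tm b _ q1 q2)).
rewrite big1 // => q1 _.
rewrite (sum_blocks_csize c2 (fun b q2 => tm _ b q1 q2)) big1 // => q2 _.
rewrite /tm ifF //; move: tot => /=; lia.
Qed.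

Lemma comp_is_ainf_functor : is_ainf_functor (comp_fmor G F).
Proof.
split.
- by move=> x; rewrite /comp_fmor /= big_seq1; exact: (fun_nil (ainfFunP G)).
- exact: comp_linear.
- exact: comp_homog.
- exact: comp_rel.
- move=> x; rewrite /comp_fmor /= big_seq1 /= (fun_one (ainfFunP F)).
  exact: (fun_one (ainfFunP G)).
- exact: comp_ones.
Qed.

Definition acomp : ainfFun A C := AinfFun comp_is_ainf_functor.

End ComposedFunctor.

Section IdentityFunctor.
Variable A : ainfCat.

Definition id_fmor x z (p : chain (@arr A) x z) : arr x z :=
  match p in chain _ x z return arr x z with
  | cnil x => 0 : qhom x x
  | ccons _ _ _ f p' =>
      match p' in chain _ y z return arr _ y -> arr _ z with
      | cnil _ => id
      | ccons _ _ _ _ _ => fun _ => 0 : qhom _ _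
      end f
  end.

Lemma id_fmor0 x z (p : chain (@arr A) x z) :
  (1 < csize p)%N -> id_fmor p = 0 :> qhom x z.
Proof.
by case: p => [x0|x0 y0 z0 f p] //=; case: p f => [x1|x1 y1 z1 e p] f.
Qed.

Lemma id_fmor_mid0 x y z t (p : chain (@arr A) x y) (f : arr y z)
    (q : chain (@arr A) z t) :
  (0 < csize p + csize q)%N -> id_fmor (ccat p (ccons f q)) = 0 :> qhom x t.
Proof. by move=> pq; apply: id_fmor0; rewrite csize_cat /=; lia. Qed.

Lemma sum_blocks_id (W : A -> A -> lmodType R)
    (mu : forall x z, chain (@arr A) x z -> W x z) :
  multilinear mu -> forall w x z (r : chain (@arr A) w x) (p : chain (@arr A) x z),
  \sum_(q <- blocks p) mu _ _ (ccat r (chmap (phi := id) id_fmor q)) =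
  mu _ _ (ccat r p).
Proof.
move=> muL w x z r p; elim: p r => [x0|x0 y0 z0 f p IH] r.
  by rewrite /= big_seq1.
rewrite (sum_blocks_head f p
  (fun q => mu w z0 (ccat r (chmap (phi := id) id_fmor q)))).
rewrite (sum_splits_nil (fun y a b => \sum_(q <- blocks b)
  mu w z0 (ccat r (chmap (phi := id) id_fmor (ccons (ccons f a) q))))).
  have E u (s : chain (@arr A) y0 u) :
    ccat r (ccons f s) = ccat (ccat r (chain1 f)) s by rewrite -ccatA.
  rewrite E -IH; apply: eq_bigr => q _.
  by rewrite -E.
move=> y y' g a b; apply: big1 => q _ /=.
exact: (multilinear0 muL).
Qed.

Lemma id_linear : multilinear (W := @qhom A) id_fmor.
Proof.
move=> x y z t p a f g q.
have [s0|s0] := posnP (csize p + csize q); last first.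
  by rewrite !id_fmor_mid0 // scaler0 addr0.
by case: p f g s0 => [x0|//] f g; case: q f g.
Qed.

Lemma id_is_ainf_functor : @is_ainf_functor A A id id_fmor.
Proof.
split.
- by [].
- exact: id_linear.
- move=> x z p; case: p => [x0|x0 y0 z0 f p] /=; first exact: homog0.
  case: p f => [x1|x1 y1 z1 e p] f /=; last exact: homog0.
  by rewrite addr0 addrNK; apply: hvalP.
- move=> x z p.
  rewrite (sum_blocks_id (m_linear (ainfCatP A)) (cnil x) (cval p)) /=.
  rewrite insertion_sumE; [|exact: id_linear|exact: m_nil (ainfCatP A)].
  rewrite (sum_splits_nil (fun y p1 w => \sum_(t <- splits w)
    sg (rdeg p1) *: (id_fmor (ccat (cval p1)
      (ccons (am (cval (cfst t))) (cval (csnd t)))) : qhom x z))); last first.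
    move=> y y' f a b; apply: big1 => t _.
    by rewrite id_fmor_mid0 ?scaler0.
  rewrite (sum_splits_nilr (fun y p2 p3 => sg 0 *:
    (id_fmor (ccons (am (cval p2)) (cval p3)) : qhom x z))) /=.
    by rewrite /sg scale1r.
  by move=> y y' f a b; rewrite /= scaler0.
- by [].
- by move=> x y z p q; apply: id_fmor_mid0.
Qed.

Definition aid : ainfFun A A := AinfFun id_is_ainf_functor.

End IdentityFunctor.
Lemma ainfFun_eq (A B : ainfCat) (F0 : A -> B)
    (F F' : forall x z, chain (@arr A) x z -> arr (F0 x) (F0 z))
    (FP : is_ainf_functor F) (FP' : is_ainf_functor F') :
  (forall x z p, F x z p = F' x z p) -> AinfFun FP = AinfFun FP'.
Proof.
move=> FF'; have E : F = F'.
  by apply: functional_extensionality_dep => x; apply: functional_extensionality_dep => z;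
     apply: functional_extensionality_dep => p.
clear FF'; case: F' / E FP' => FP'; congr AinfFun; exact: Prop_irrelevance.
Qed.

Lemma acomp_idl (A B : ainfCat) (F : ainfFun A B) : acomp (aid B) F = F.
Proof.
case: F => F0 F FP; apply: ainfFun_eq => x z p; rewrite /comp_fmor /=.
case: p => [x0|x0 y0 z0 f p].
  by rewrite /= big_seq1 /=; rewrite (fun_nil FP).
rewrite (sum_blocks_head f p (fun q => id_fmor (chmap F q) : qhom (F0 x0) (F0 z0))).
rewrite (sum_splits_nilr (fun y a b => \sum_(q <- blocks b)
  (id_fmor (chmap F (ccons (ccons f a) q)) : qhom (F0 x0) (F0 z0)))).
  by rewrite /= big_seq1.
move=> y y' g a b.
apply: (sum_blocks_nil (fun q => id_fmor (chmap F (ccons (ccons f a) q)) : qhom (F0 x0) (F0 z0))).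
by move=> y1 b' q; apply: id_fmor0.
Qed.

Lemma acomp_idr (A B : ainfCat) (F : ainfFun A B) : acomp F (aid A) = F.
Proof.
case: F => F0 F FP; apply: ainfFun_eq => x z p.
exact: (sum_blocks_id (fun_linear FP) (cnil x) p).
Qed.

Lemma acompA (A B C D : ainfCat) (H : ainfFun C D) (G : ainfFun B C)
    (F : ainfFun A B) : acomp H (acomp G F) = acomp (acomp H G) F.
Proof.
apply: ainfFun_eq => x z p; rewrite /comp_fmor.
under eq_bigr => q _ do rewrite [fmor H _](multilinear_choices (fun_linear (ainfFunP H))
  (phi := comp_fob G F) (@blocks A (@arr A))
  (fun x y q => fmor G (chmap (@fmor _ _ F) q)) (cnil (comp_fob G F x))).
rewrite -(sum_blocks_blocks p (fun Q => fmor H (chmap (phi := comp_fob G F)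
  (fun x0 y0 e' => fmor G (chmap (@fmor _ _ F) e')) Q) : qhom _ _)).
apply: eq_bigr => q _ /=; rewrite /comp_fmor blocks_chmap big_map.
by apply: eq_bigr => Q _; rewrite chmap_comp.
Qed.

Section QuasiEquivalence.

Definition cocycle (A : ainfCat) (x y : A) (d : int) (f : arr x y) : Prop :=
  homog (M := qhom x y) d f /\ am (chain1 f) = 0 :> qhom x y.

(* Equality of the classes of two cocycles of degree d in H^d(Hom(x, y)).     *)
Definition cohomologous (A : ainfCat) (x y : A) (d : int) (f g : qhom x y) :
    Prop :=
  exists2 h : arr x y, homog (M := qhom x y) (d - 1) h & am (chain1 h) = f - g.

Definition H0_isomorphic (A : ainfCat) (x y : A) : Prop :=
  exists (f : arr x y) (g : arr y x),
    [/\ cocycle 0 f, cocycle 0 g,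
        cohomologous 0 (am (ccons f (chain1 g))) (aone x)
      & cohomologous 0 (am (ccons g (chain1 f))) (aone y)].

(* F^1 is injective, resp. surjective, on cohomology in each degree.          *)
Definition quasi_isomorphic_on_homs (A B : ainfCat) (F : ainfFun A B) : Prop :=
  forall (x y : A) (d : int),
    (forall f g : arr x y, cocycle d f -> cocycle d g ->
       cohomologous d (fmor F (chain1 f)) (fmor F (chain1 g)) ->
       cohomologous d f g) /\
    (forall g : arr (F x) (F y), cocycle d g ->
       exists2 f : arr x y, cocycle d f & cohomologous d (fmor F (chain1 f)) g).

Definition H0_essentially_surjective (A B : ainfCat) (F : ainfFun A B) : Prop :=
  forall y : B, exists x : A, H0_isomorphic (F x) y.

Definition quasi_equivalence (A B : ainfCat) (F : ainfFun A B) : Prop :=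
  quasi_isomorphic_on_homs F /\ H0_essentially_surjective F.

End QuasiEquivalence.

Section Transformations.
Variables A B : ainfCat.

(* Strictly unital prenatural transformations of degree g; T^n is the value   *)
(* on chains of length n, and T^0(x) is the value on cnil x.                  *)
Record is_prenatural (F G : ainfFun A B) (g : int)
    (T : forall x z, chain (@arr A) x z -> arr (F x) (G z)) : Prop :=
  IsPrenatural {
  nat_linear : multilinear (W := fun x z => qhom (F x) (G z)) T;
  nat_homog : forall x z (p : chain (@harr A) x z),
    homog (M := qhom (F x) (G z)) (rdeg p + g) (T _ _ (cval p));
  nat_ones : forall x y z (p : chain (@arr A) x y) (q : chain (@arr A) y z),
    T _ _ (ccat p (ccons (aone y) q)) = 0 :> qhom (F x) (G z)
}.

Record prenatural (F G : ainfFun A B) (g : int) := Prenatural {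
  tmor :> forall x z, chain (@arr A) x z -> arr (F x) (G z);
  prenaturalP : is_prenatural g tmor
}.

(* The differential, evaluated at a chain of homogeneous morphisms: T takes   *)
(* the middle piece of p, which may be empty, and F and G the nonempty blocks *)
(* of the pieces before and after it.                                         *)
Definition M1 (F G : ainfFun A B) (g : int) (T : prenatural F G g)
    x z (p : chain (@harr A) x z) : qhom (F x) (G z) :=
  \sum_(s <- splits p) \sum_(t <- splits (csnd s))
    \sum_(q1 <- blocks (cval (cfst s))) \sum_(q2 <- blocks (cval (csnd t)))
      sg ((g - 1) * rdeg (cfst s)) *:
        (am (ccat (chmap (@fmor _ _ F) q1)
               (ccons (T _ _ (cval (cfst t))) (chmap (@fmor _ _ G) q2)))
         : qhom (F x) (G z))
  - sg (g - 1) *: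
      insertion_sum (@am A) (W := fun x z => qhom (F x) (G z)) T p.

Definition M2 (F G K : ainfFun A B) (g2 g1 : int)
    (T2 : prenatural G K g2) (T1 : prenatural F G g1)
    x z (p : chain (@harr A) x z) : qhom (F x) (K z) :=
  \sum_(s <- splits p) \sum_(t <- splits (csnd s))
  \sum_(u <- splits (csnd t)) \sum_(v <- splits (csnd u))
    \sum_(q1 <- blocks (cval (cfst s)))
    \sum_(q2 <- blocks (cval (cfst u)))
    \sum_(q3 <- blocks (cval (csnd v)))
      sg ((g1 - 1) * rdeg (cfst s) +
          (g2 - 1) * (rdeg (cfst s) + rdeg (cfst t) + rdeg (cfst u))) *:
        (am (ccat (chmap (@fmor _ _ F) q1)
              (ccons (T1 _ _ (cval (cfst t)))
                (ccat (chmap (@fmor _ _ G) q2)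
                  (ccons (T2 _ _ (cval (cfst v))) (chmap (@fmor _ _ K) q3)))))
         : qhom (F x) (K z)).

Definition Id_tr (F : ainfFun A B) x z (p : chain (@harr A) x z) :
    qhom (F x) (F z) :=
  match p in chain _ x z return qhom (F x) (F z) with
  | cnil x => aone (F x)
  | ccons _ _ _ _ _ => 0
  end.

Definition nat_closed (F G : ainfFun A B) (g : int) (T : prenatural F G g) : Prop :=
  forall x z (p : chain (@harr A) x z), M1 T p = 0.

Definition weakly_equivalent (F G : ainfFun A B) : Prop :=
  exists (T : prenatural F G 0) (S : prenatural G F 0)
         (H : prenatural F F (-1)) (H' : prenatural G G (-1)),
    [/\ nat_closed T, nat_closed S,
        forall x z (p : chain (@harr A) x z), M2 S T p = Id_tr F p + M1 H p
      & forall x z (p : chain (@harr A) x z), M2 T S p = Id_tr G p + M1 H' p].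

End Transformations.
End Graded.

Record category := Category {
  cob :> Type;
  chom : cob -> cob -> Type;
  cidm : forall x, chom x x;
  ccomp : forall x y z, chom y z -> chom x y -> chom x z;
  ccomp_idl : forall x y (f : chom x y), ccomp (cidm y) f = f;
  ccomp_idr : forall x y (f : chom x y), ccomp f (cidm x) = f;
  ccompA : forall x y z t (h : chom z t) (g : chom y z) (f : chom x y),
    ccomp h (ccomp g f) = ccomp (ccomp h g) f
}.

Section Localization.
Variables (C : category) (W : forall x y : C, chom x y -> Prop).

(* The localization of C at W: zigzags of morphisms of C and of formal        *)
(* inverses of morphisms in W, modulo the congruence zz_eq.                   *)
Inductive zigzag : C -> C -> Type :=
| znil x : zigzag x x
| zfwd x y z of chom x y & zigzag y z : zigzag x z
| zbwd x y z (w : chom y x) of W w & zigzag y z : zigzag x z.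

Fixpoint zcat x y (p : zigzag x y) : forall z, zigzag y z -> zigzag x z :=
  match p in zigzag x y return forall z, zigzag y z -> zigzag x z with
  | znil _ => fun _ q => q
  | zfwd _ _ _ f p' => fun _ q => zfwd f (zcat p' q)
  | zbwd _ _ _ _ Ww p' => fun _ q => zbwd Ww (zcat p' q)
  end.

Lemma zcat0 x y (p : zigzag x y) : zcat p (znil y) = p.
Proof. by elim: p => //= [? ? ? f p ->|? ? ? w Ww p ->]. Qed.

Lemma zcatA x y z t (p : zigzag x y) (q : zigzag y z) (r : zigzag z t) :
  zcat p (zcat q r) = zcat (zcat p q) r.
Proof.
by elim: p q => //= [? ? ? f p IH|? ? ? w Ww p IH] q; rewrite IH.
Qed.

Inductive zz_eq : forall x y, zigzag x y -> zigzag x y -> Prop :=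
| zz_refl x y (p : zigzag x y) : zz_eq p p
| zz_sym x y (p q : zigzag x y) : zz_eq p q -> zz_eq q p
| zz_trans x y (p q r : zigzag x y) : zz_eq p q -> zz_eq q r -> zz_eq p r
| zz_cat x y z (p p' : zigzag x y) (q q' : zigzag y z) :
    zz_eq p p' -> zz_eq q q' -> zz_eq (zcat p q) (zcat p' q')
| zz_id x : zz_eq (zfwd (cidm x) (znil x)) (znil x)
| zz_comp x y z (f : chom x y) (g : chom y z) :
    zz_eq (zfwd f (zfwd g (znil z))) (zfwd (ccomp g f) (znil z))
| zz_fwd_bwd x y (w : chom x y) (Ww : W w) :
    zz_eq (zfwd w (zbwd Ww (znil x))) (znil x)
| zz_bwd_fwd x y (w : chom x y) (Ww : W w) :
    zz_eq (zbwd Ww (zfwd w (znil y))) (znil y).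

Section Quotient.
Variables x y : C.

(* The morphisms of the localization are the equivalence classes of zz_eq     *)
(* (as sets: zigzags form a large type, out of reach of choiceType quotients).*)
Definition lhom : Type := {P : zigzag x y -> Prop | exists p, P = zz_eq p}.

Definition lclass (p : zigzag x y) : lhom :=
  exist _ (zz_eq p) (ex_intro _ p erefl).

Definition lrepr (a : lhom) : zigzag x y := sval (cid (svalP a)).

Lemma lreprK a : lclass (lrepr a) = a.
Proof.
case: a => P eP; rewrite /lrepr; case: (cid _) => p /= Pp.
by apply: eq_exist; rewrite Pp.
Qed.

Lemma lclassP (p q : zigzag x y) : lclass p = lclass q <-> zz_eq p q.
Proof.
split=> [pq | pq].
  have /= <- := congr1 (fun a : lhom => sval a q) (esym pq).
  exact: zz_refl.
apply: eq_exist; apply/funext => r; apply/propext.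
by split=> [pr | qr]; [apply: zz_trans pr; apply: zz_sym | apply: zz_trans qr].
Qed.

End Quotient.

Definition lid (x : C) : lhom x x := lclass (znil x).

Definition lcomp x y z (b : lhom y z) (a : lhom x y) : lhom x z :=
  lclass (zcat (lrepr a) (lrepr b)).

Lemma lcompE x y z (q : zigzag y z) (p : zigzag x y) :
  lcomp (lclass q) (lclass p) = lclass (zcat p q).
Proof. by apply/lclassP; apply: zz_cat; apply/lclassP; rewrite lreprK. Qed.

Lemma lcomp_idl x y (a : lhom x y) : lcomp (lid y) a = a.
Proof. by rewrite -[a]lreprK lcompE zcat0. Qed.

Lemma lcomp_idr x y (a : lhom x y) : lcomp a (lid x) = a.
Proof. by rewrite -[a]lreprK lcompE. Qed.

Lemma lcompA x y z t (c : lhom z t) (b : lhom y z) (a : lhom x y) :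
  lcomp c (lcomp b a) = lcomp (lcomp c b) a.
Proof. by rewrite -[a]lreprK -[b]lreprK -[c]lreprK !lcompE zcatA. Qed.

Definition localization : category := Category lcomp_idl lcomp_idr lcompA.

Definition loc (x y : C) (f : chom x y) : @chom localization x y :=
  lclass (zfwd f (znil y)).

Lemma loc_id (x : C) : loc (cidm x) = @cidm localization x.
Proof. by apply/lclassP; apply: zz_id. Qed.

Lemma loc_comp (x y z : C) (g : chom y z) (f : chom x y) :
  loc (ccomp g f) = @ccomp localization x y z (loc g) (loc f).
Proof. by rewrite /= lcompE; apply/lclassP; apply/zz_sym/zz_comp. Qed.

Lemma loc_inv (x y : C) (w : chom x y) : W w ->
  exists v : @chom localization y x,
    @ccomp localization x y x v (loc w) = @cidm localization x /\
    @ccomp localization y x y (loc w) v = @cidm localization y.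
Proof.
move=> Ww; exists (lclass (zbwd Ww (znil x))); rewrite /= !lcompE.
by split; apply/lclassP; [apply: zz_fwd_bwd | apply: zz_bwd_fwd].
Qed.

End Localization.

Definition AinfCats (R : comPzRingType) : category :=
  @Category (ainfCat R) (@ainfFun R) (@aid R) (fun _ _ _ => @acomp R _ _ _)
    (@acomp_idl R) (@acomp_idr R) (@acompA R).

Definition HoAinfCats (R : comPzRingType) : category :=
  localization (C := AinfCats R) (@quasi_equivalence R).

Definition ho_class (R : comPzRingType) (A B : ainfCat R) (F : ainfFun A B) :
    @chom (HoAinfCats R) A B :=
  loc (C := AinfCats R) (@quasi_equivalence R) F.

(* Main.v *)
Require Import Defs.
From HB Require Import structures.
From mathcomp Require Import all_boot all_algebra.
From mathcomp Require Import zify boolp.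

Set Implicit Arguments.
Unset Strict Implicit.
Unset Printing Implicit Defensive.

Import GRing.Theory.

Local Open Scope ring_scope.

(** The idea is that of a path object.  To B one associates an A-infinity
    category of paths, [pathCat B]: its objects are the closed degree 0
    morphisms f : x -> y of B that are invertible in H^0, and a morphism from
    f to f' is a triple (a, b, h) with a : x -> x', b : y -> y' and a homotopy
    h : x -> y' of degree one less.  It is the category of upper triangular
    2 by 2 matrices over B, twisted by the Maurer-Cartan element f: in the
    third component of an operation one sums over all the ways of going along
    the a's, crossing once through some f or some h, and continuing along the
    b's.  The crossing terms of this sum are exactly those of the differential
    of prenatural transformations, so a closed transformation T of degree 0
    from F to G, with each T^0(x) invertible in H^0, is the same thing as a
    functor into [pathCat B] with ends F and G ([natFun]).

    The two ends [srcFun] and [tgtFun] are strict functors to B, with a common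
    section [constFun] sending x to its identity.  The functor [srcFun] is a
    quasi-equivalence: it is onto on objects, and on morphisms it is onto with
    kernel, up to a shift, the cone of the composition with f from Hom(y, y')
    to Hom(x, y'); this composition is a quasi-isomorphism because f is
    invertible in H^0, so the kernel is acyclic ([srcFun_quasi_iso]).
    In the localization the section is therefore a two-sided inverse of
    [srcFun], and as it is a section of [tgtFun] too, the two ends become
    equal ([ho_srcFun_tgtFun]).  Composing with [natFun] gives the theorem: a
    weak equivalence provides T, whose values T^0(x) are invertible in H^0 by
    the degree zero part of the two homotopy equations. *)

(** * Cutting chains into pieces *)

Section Cuts.
Context {O : Type} {E : O -> O -> Type} {V : nmodType}.

Definition cut3 x z (p : chain E x z)
    (phi : forall u v, chain E x u -> chain E u v -> chain E v z -> V) : V :=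
  \sum_(s <- splits p) \sum_(t <- splits (csnd s))
    phi _ _ (cfst s) (cfst t) (csnd t).

(** Two marked pieces of a chain, disjoint or one inside the other, cut it into
    five; [cut3_first], [cut3_middle] and [cut3_ends] put the double sums over
    such pairs into this form, in which they can be compared. *)
Definition cut5 x z (p : chain E x z)
    (phi : forall t u v w, chain E x t -> chain E t u -> chain E u v ->
      chain E v w -> chain E w z -> V) : V :=
  cut3 p (fun _ _ a b r => cut3 r (fun _ _ c d e => phi _ _ _ _ a b c d e)).

Lemma eq_cut3 x z (p : chain E x z) phi psi :
  (forall u v a b c, phi u v a b c = psi u v a b c) -> cut3 p phi = cut3 p psi.
Proof. by move=> H; do 2![apply: eq_bigr => ? _]. Qed.

Lemma cut3D x z (p : chain E x z) phi psi :
  cut3 p (fun u v a b c => phi u v a b c + psi u v a b c) =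
  cut3 p phi + cut3 p psi.
Proof. by rewrite /cut3 -big_split; apply: eq_bigr => s _; rewrite big_split. Qed.

Lemma cut3_first x z (p : chain E x z)
    (phi : forall t u v w, chain E x t -> chain E t u -> chain E u v ->
      chain E v w -> chain E w z -> V) :
  cut3 p (fun _ _ r d e => cut3 r (fun _ _ a b c => phi _ _ _ _ a b c d e)) =
  cut5 p phi.
Proof.
rewrite /cut5 /cut3.
under eq_bigr => s _ do rewrite exchange_big /=.
rewrite (splitsA p (fun _ _ a r q => \sum_(t <- splits q) \sum_(v <- splits r)
  phi _ _ _ _ a (cfst v) (csnd v) (cfst t) (csnd t))).
apply: eq_bigr => s _; under eq_bigr => t _ do rewrite exchange_big /=.
by rewrite (splitsA (csnd s) (fun _ _ b c q => \sum_(t <- splits q)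
  phi _ _ _ _ (cfst s) b c (cfst t) (csnd t))).
Qed.

Lemma cut3_middle x z (p : chain E x z)
    (phi : forall t u v w, chain E x t -> chain E t u -> chain E u v ->
      chain E v w -> chain E w z -> V) :
  cut3 p (fun _ _ a r e => cut3 r (fun _ _ b c d => phi _ _ _ _ a b c d e)) =
  cut5 p phi.
Proof.
apply: eq_bigr => s _.
rewrite (splitsA (csnd s) (fun _ _ b r e => \sum_(v <- splits r)
  phi _ _ _ _ (cfst s) b (cfst v) (csnd v) e)).
apply: eq_bigr => t _.
by rewrite (splitsA (csnd t) (fun _ _ c d e =>
  phi _ _ _ _ (cfst s) (cfst t) c d e)).
Qed.

Lemma cut3_ends x z (p : chain E x z)
    (phi : forall t u v w, chain E x t -> chain E t u -> chain E u v ->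
      chain E v w -> chain E w z -> V) :
  cut3 p (fun _ _ l c r => \sum_(s <- splits l) \sum_(t <- splits r)
    phi _ _ _ _ (cfst s) (csnd s) c (cfst t) (csnd t)) =
  cut5 p phi.
Proof.
rewrite /cut5 /cut3.
under eq_bigr => s _ do rewrite exchange_big /=.
by rewrite (splitsA p (fun _ _ a b r => \sum_(t <- splits r)
  \sum_(v <- splits (csnd t)) phi _ _ _ _ a b (cfst t) (cfst v) (csnd v))).
Qed.

(** A cut of a chain with a distinguished edge e falls before or after e. *)
Lemma sum_splits_cat x y z t (a : chain E x y) (e : E y z) (c : chain E z t)
    (phi : forall u, chain E x u -> chain E u t -> V) :
  \sum_(s <- splits (ccat a (ccons e c))) phi _ (cfst s) (csnd s) =
  \sum_(s <- splits a) phi _ (cfst s) (ccat (csnd s) (ccons e c)) +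
  \sum_(s <- splits c) phi _ (ccat a (ccons e (cfst s))) (csnd s).
Proof.
elim: a e phi => [x0|x0 y0 z0 f a IH] e phi.
  by rewrite /= big_cons big_map big_seq1.
rewrite [ccat _ _]/= (sum_splitsS f _ phi).
rewrite (sum_splitsS f a (fun u p q => phi u p (ccat q (ccons e c)))).
by rewrite (IH e (fun u p => phi u (ccons f p))) addrA.
Qed.

(** The three sums are the cuts with the distinguished edge in the last, the
    middle and the first piece; this is how an operation applied to the result
    of another one is expanded. *)
Lemma cut3_cat x y z t (a : chain E x y) (e : E y z) (c : chain E z t)
    (phi : forall u v, chain E x u -> chain E u v -> chain E v t -> V) :
  cut3 (ccat a (ccons e c)) phi =
  cut3 a (fun _ _ a1 a2 a3 => phi _ _ a1 a2 (ccat a3 (ccons e c))) +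
  \sum_(s <- splits a) \sum_(u <- splits c)
    phi _ _ (cfst s) (ccat (csnd s) (ccons e (cfst u))) (csnd u) +
  cut3 c (fun _ _ c1 c2 c3 => phi _ _ (ccat a (ccons e c1)) c2 c3).
Proof.
rewrite {1}/cut3 (sum_splits_cat a e c (fun u p q =>
  \sum_(t <- splits q) phi _ _ p (cfst t) (csnd t))); congr (_ + _).
rewrite -big_split; apply: eq_bigr => s _ /=.
by rewrite (sum_splits_cat (csnd s) e c (fun u p q => phi _ _ (cfst s) p q)).
Qed.

End Cuts.

Lemma cut3_chmap (V : nmodType) (O1 O2 : Type) (E1 : O1 -> O1 -> Type)
    (E2 : O2 -> O2 -> Type) (f : O1 -> O2)
    (h : forall x y, E1 x y -> E2 (f x) (f y)) x z (p : chain E1 x z)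
    (phi : forall u v, chain E2 (f x) u -> chain E2 u v -> chain E2 v (f z) ->
      V) :
  cut3 (chmap h p) phi =
  cut3 p (fun _ _ a b c => phi _ _ (chmap h a) (chmap h b) (chmap h c)).
Proof.
rewrite /cut3 (sum_splits_chmap h p (fun u a r =>
  \sum_(t <- splits r) phi _ _ a (cfst t) (csnd t))).
apply: eq_bigr => s _.
by rewrite (sum_splits_chmap h (csnd s) (fun u b c =>
  phi _ _ (chmap h (cfst s)) b c)).
Qed.

Lemma cut3_nil (O : Type) (E : O -> O -> Type) (V : nmodType) (x : O)
    (phi : forall u v, chain E x u -> chain E u v -> chain E v x -> V) :
  cut3 (cnil x) phi = phi _ _ (cnil x) (cnil x) (cnil x).
Proof. by rewrite /cut3 /= !big_seq1. Qed.

Lemma cut3_chain1 (O : Type) (E : O -> O -> Type) (V : nmodType) (x y : O)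
    (e : E x y)
    (phi : forall u v, chain E x u -> chain E u v -> chain E v y -> V) :
  cut3 (chain1 e) phi = phi _ _ (cnil x) (cnil x) (chain1 e) +
    phi _ _ (cnil x) (chain1 e) (cnil y) + phi _ _ (chain1 e) (cnil y) (cnil y).
Proof. by rewrite /cut3 /= !(big_cons, big_nil) /= !addr0. Qed.

Lemma cut3_eq0 (O : Type) (E : O -> O -> Type) (V : nmodType) (x z : O)
    (p : chain E x z)
    (phi : forall u v, chain E x u -> chain E u v -> chain E v z -> V) :
  (forall u v (a : chain E x u) (b : chain E u v) c,
     (csize a + csize b + csize c = csize p)%N -> phi _ _ a b c = 0) ->
  cut3 p phi = 0.
Proof.
move=> H; apply: (sum_splits_eq0 (fun u a r => \sum_(t <- splits r)
  phi _ _ a (cfst t) (csnd t))) => u a r ar.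
by apply: (sum_splits_eq0 (fun v b c => phi _ _ a b c)) => v b c bc; apply: H; lia.
Qed.

Lemma cut3_morph (V W : nmodType) (f : V -> W) (O : Type) (E : O -> O -> Type)
    (x z : O) (p : chain E x z)
    (phi : forall u v, chain E x u -> chain E u v -> chain E v z -> V) :
  f 0 = 0 -> {morph f : a b / a + b} ->
  f (cut3 p phi) = cut3 p (fun u v a b c => f (phi u v a b c)).
Proof.
move=> f0 fD; rewrite /cut3 (big_morph f fD f0); apply: eq_bigr => s _.
by rewrite (big_morph f fD f0).
Qed.

Lemma cut3N (M : zmodType) (O : Type) (E : O -> O -> Type) x z
    (p : chain E x z)
    (phi : forall u v, chain E x u -> chain E u v -> chain E v z -> M) :
  - cut3 p phi = cut3 p (fun u v a b c => - phi u v a b c).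
Proof. by rewrite -sumrN; apply: eq_bigr => s _; rewrite -sumrN. Qed.

Lemma scaler_cut3 (R : pzRingType) (M : lmodType R) (O : Type)
    (E : O -> O -> Type) x z (p : chain E x z) k
    (phi : forall u v, chain E x u -> chain E u v -> chain E v z -> M) :
  k *: cut3 p phi = cut3 p (fun u v a b c => k *: phi u v a b c).
Proof. by rewrite scaler_sumr; apply: eq_bigr => s _; rewrite scaler_sumr. Qed.

(** Cutting the sequence of blocks in three amounts to cutting the chain in
    three and each piece in blocks: this compares the operations of the path
    category on the blocks of a functor with the differential of a
    transformation. *)
Lemma sum_blocks_cut3 (O : Type) (E : O -> O -> Type) (V : nmodType) x z
    (p : chain E x z)
    (phi : forall u v, chain (chain E) x u -> chain (chain E) u v ->
      chain (chain E) v z -> V) :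
  \sum_(q <- blocks p) cut3 q phi =
  cut3 p (fun _ _ a b c => \sum_(q1 <- blocks a) \sum_(q2 <- blocks b)
    \sum_(q3 <- blocks c) phi _ _ q1 q2 q3).
Proof.
rewrite /cut3 (sum_blocks_splits p (fun u q1 r => \sum_(t <- splits r)
  phi _ _ q1 (cfst t) (csnd t))).
apply: eq_bigr => s _.
under eq_bigr => q1 _ do rewrite (sum_blocks_splits (csnd s) (fun u q2 q3 =>
  phi _ _ q1 q2 q3)).
by rewrite exchange_big.
Qed.

(** * Degrees and signs *)

Section Signs.
Variable R : comPzRingType.

Lemma gcomp_sum (M : gmod R) (c : int -> R) (s : seq int) (v : M) e : uniq s ->
  gcomp M e (\sum_(d <- s) c d *: gcomp M d v) =
  if e \in s then c e *: gcomp M e v else 0.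
Proof.
move=> us; rewrite linear_sum /=.
under eq_bigr => d _ do rewrite linearZ /= gcompK.
case: ifP => [es|/negbT es].
  rewrite (bigD1_seq e) //= eqxx big1 ?addr0 // => d /negbTE ed.
  by rewrite eq_sym ed scaler0.
rewrite big_seq big1 // => d ds; case: eqP => [ed|_]; last by rewrite scaler0.
by rewrite ed ds in es.
Qed.

Lemma gcomp_inj (M : gmod R) (v w : M) :
  (forall d, gcomp M d v = gcomp M d w) -> v = w.
Proof.
move=> H; apply/eqP; rewrite -subr_eq0; apply/eqP.
have [s _ ->] := gcomp_fin (v - w).
by rewrite big1 // => d _; rewrite linearB /= H subrr.
Qed.

Lemma gcomp_out (M : gmod R) (v : M) (s : seq int) e : uniq s ->
  v = \sum_(d <- s) gcomp M d v -> e \notin s -> gcomp M e v = 0.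
Proof.
move=> us -> es; under eq_bigr => d _ do rewrite -[gcomp M d v]scale1r.
by rewrite (gcomp_sum (fun=> 1)) // (negbTE es).
Qed.

Lemma gcomp_sub (M : gmod R) (v : M) (s s' : seq int) : uniq s -> uniq s' ->
  {subset s <= s'} -> v = \sum_(d <- s) gcomp M d v ->
  v = \sum_(d <- s') gcomp M d v.
Proof.
move=> us us' ss' vE; apply: gcomp_inj => e.
under eq_bigr => d _ do rewrite -[gcomp M d v]scale1r.
rewrite (gcomp_sum (fun=> 1)) //; case: ifP => [_|/negbT es].
  by rewrite scale1r.
by apply: gcomp_out vE _ => //; apply: contra es; apply: ss'.
Qed.

(** The signs of the path category depend on the degrees of the morphisms,
    whereas operations act on all morphisms; so the sign is extended linearly
    from the homogeneous parts.  The choice of a finite family of degrees does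
    not matter, see [gcomp_degsign]. *)
Definition degsign (M : gmod R) (v : M) : M :=
  \sum_(d <- s2val (cid2 (gcomp_fin v))) sg R (d - 1) *: gcomp M d v.

Lemma gcomp_degsign (M : gmod R) (v : M) e :
  gcomp M e (degsign v) = sg R (e - 1) *: gcomp M e v.
Proof.
rewrite /degsign; case: (cid2 _) => s us vE /=.
rewrite (gcomp_sum (fun d => sg R (d - 1))) //; case: ifP => // /negbT es.
by rewrite (gcomp_out us vE es) scaler0.
Qed.

Lemma degsign_linear (M : gmod R) a (v w : M) :
  degsign (a *: v + w) = a *: degsign v + degsign w.
Proof.
apply: gcomp_inj => d; rewrite linearP /= !gcomp_degsign linearP /= scalerDr.
by rewrite !scalerA mulrC.
Qed.

Lemma degsign_homog (M : gmod R) d (v : M) :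
  homog d v -> degsign v = sg R (d - 1) *: v.
Proof.
move=> vd; apply: gcomp_inj => e; rewrite gcomp_degsign linearZ /= -vd gcompK.
by case: eqP => [->//|_]; rewrite !scaler0.
Qed.

Lemma sgN k : sg R (- k) = sg R k.
Proof. by rewrite /sg abszN. Qed.

Lemma sgS k : sg R (k + 1) = - sg R k.
Proof. by rewrite sgD /sg expr1 mulrN1. Qed.

Lemma sgB1 k : sg R (k - 1) = - sg R k.
Proof. by rewrite sgD sgN /sg expr1 mulrN1. Qed.

Lemma sgK k : sg R k * sg R k = 1.
Proof. by rewrite /sg -expr2 -exprM mulnC exprM sqrrN expr1n expr1n. Qed.

Section Triple.
Variables M1 M2 M3 : gmod R.

(** In the third summand the degree is lowered by one: the homotopy h of a
    morphism of degree d of paths has degree d - 1. *)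
Definition tcomp d (v : M1 * M2 * M3) : M1 * M2 * M3 :=
  (gcomp M1 d v.1.1, gcomp M2 d v.1.2, gcomp M3 (d - 1) v.2).

Lemma tcomp_linear d : linear (tcomp d).
Proof. by move=> a v w; rewrite /tcomp /= !linearP. Qed.

HB.instance Definition _ d :=
  GRing.isLinear.Build R (M1 * M2 * M3)%type (M1 * M2 * M3)%type *:%R (tcomp d)
    (tcomp_linear d).

Lemma tcompK d e v : tcomp d (tcomp e v) = if d == e then tcomp e v else 0.
Proof.
rewrite /tcomp !gcompK /= (inj_eq (addIr (-1))).
by case: (d == e).
Qed.

Lemma tcomp_fin v : exists2 s, uniq s & v = \sum_(d <- s) tcomp d v.
Proof.
case: v => -[v1 v2] v3.
have [s1 u1 e1] := gcomp_fin v1; have [s2 u2 e2] := gcomp_fin v2.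
have [s3 u3 e3] := gcomp_fin v3.
pose s := undup (s1 ++ s2 ++ [seq d + 1 | d <- s3]).
have us : uniq s by apply: undup_uniq.
exists s => //.
have -> : \sum_(d <- s) tcomp d (v1, v2, v3) = (\sum_(d <- s) gcomp M1 d v1,
   \sum_(d <- s) gcomp M2 d v2, \sum_(d <- s) gcomp M3 (d - 1) v3).
  elim: s {us} => [|d s IH]; first by rewrite !big_nil.
  by rewrite !big_cons IH.
congr (_, _, _).
- by apply: gcomp_sub e1 => // d ds; rewrite mem_undup !mem_cat ds.
- by apply: gcomp_sub e2 => // d ds; rewrite mem_undup !mem_cat ds orbT.
- rewrite -(big_map (fun d => d - 1) xpredT (fun d => gcomp M3 d v3)).
  apply: gcomp_sub e3 => //; first by rewrite map_inj_uniq //; apply: addIr.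
  move=> d ds; apply/mapP; exists (d + 1); last by rewrite addrK.
  by rewrite mem_undup !mem_cat (map_f (fun d => d + 1) ds) !orbT.
Qed.

Definition triple : gmod R := GMod tcompK tcomp_fin.

End Triple.
End Signs.

Section Graded.
Variable R : comPzRingType.

(** Signs only matter modulo 2; the witness k is given explicitly because
    parity is then linear integer arithmetic. *)
Lemma sg_even a b k : a = b + k + k -> sg R a = sg R b.
Proof. by move=> ->; rewrite !sgD -mulrA sgK mulr1. Qed.

Lemma cut3_rdeg (V : nmodType) (Q : gquiver R) (x z : Q)
    (p : chain (@harr R Q) x z)
    (psi : int -> forall u v, chain (@harr R Q) x u -> chain (@harr R Q) u v ->
      chain (@harr R Q) v z -> V) :
  cut3 p (psi (rdeg p)) =
  cut3 p (fun _ _ a b c => psi (rdeg a + rdeg b + rdeg c) _ _ a b c).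
Proof.
rewrite /cut3 (sum_splits_rdeg p (fun k y a r => \sum_(t <- splits r)
  psi k _ _ a (cfst t) (csnd t))).
apply: eq_bigr => s _.
rewrite (sum_splits_rdeg (csnd s) (fun k y b c =>
  psi (rdeg (cfst s) + k) _ _ (cfst s) b c)).
by apply: eq_bigr => t _; rewrite addrA.
Qed.

Lemma homogZ (M : gmod R) d a (v : M) : homog d v -> homog d (a *: v).
Proof. by rewrite /homog linearZ /= => ->. Qed.

Lemma homogN (M : gmod R) d (v : M) : homog d v -> homog d (- v).
Proof. by rewrite /homog linearN /= => ->. Qed.

Lemma homogD (M : gmod R) d (v w : M) : homog d v -> homog d w -> homog d (v + w).
Proof. by rewrite /homog linearD /= => -> ->. Qed.

Lemma cut3_homog (M : gmod R) (Q : gquiver R) (x z : Q)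
    (p : chain (@harr R Q) x z) (k : int)
    (phi : forall u v, chain (@harr R Q) x u -> chain (@harr R Q) u v ->
      chain (@harr R Q) v z -> M) :
  (forall u v a b c, homog (rdeg a + rdeg b + rdeg c + k) (phi u v a b c)) ->
  homog (rdeg p + k) (cut3 p phi).
Proof.
move=> H; rewrite /homog {2}/cut3 linear_sum /=.
transitivity (cut3 p (fun u v a b c => gcomp M (rdeg p + k) (phi u v a b c))).
  by apply: eq_bigr => s _; rewrite linear_sum.
rewrite (cut3_rdeg p (fun d u v a b c => gcomp M (d + k) (phi u v a b c))).
exact: eq_cut3.
Qed.

Lemma triple_homog (M1 M2 M3 : gmod R) d (v : triple M1 M2 M3) :
  homog d v <-> [/\ homog d v.1.1, homog d v.1.2 & homog (d - 1) v.2].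
Proof.
case: v => -[v1 v2] v3; split => [vd|[/= e1 e2 e3]].
  by split; [exact: (congr1 (fun w => w.1.1) vd)
    | exact: (congr1 (fun w => w.1.2) vd) | exact: (congr1 snd vd)].
by rewrite /homog /= /tcomp /= e1 e2 e3.
Qed.

Lemma multilinearN (Q : gquiver R) (W : Q -> Q -> lmodType R)
    (mu : forall x z, chain (@arr R Q) x z -> W x z) : multilinear mu ->
  forall x y z t (p : chain (@arr R Q) x y) (f : qhom y z)
    (q : chain (@arr R Q) z t),
  mu _ _ (ccat p (ccons (- f : arr _ _) q)) =
  - mu _ _ (ccat p (ccons (f : arr _ _) q)).
Proof. by move=> muL x y z t p f q; rewrite -!scaleN1r (multilinearZ muL). Qed.

Lemma cval_cat (Q : gquiver R) (x y z : Q) (p : chain (@harr R Q) x y)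
    (q : chain (@harr R Q) y z) : cval (ccat p q) = ccat (cval p) (cval q).
Proof. exact: chmap_cat. Qed.

Lemma cval_cons (Q : gquiver R) (x y z : Q) (f : harr x y)
    (p : chain (@harr R Q) y z) :
  cval (ccons f p) = ccons (hval f : arr _ _) (cval p).
Proof. by []. Qed.

(** On homogeneous arguments the linear sign operator gives back the usual
    sign, (-1) to the total reduced degree of the arguments. *)
Lemma chmap_degsign (Q : gquiver R) (W : Q -> Q -> lmodType R)
    (mu : forall x z, chain (@arr R Q) x z -> W x z)
    (O : Type) (D : O -> O -> Type) (phi : O -> Q)
    (h : forall x y, D x y -> harr (phi x) (phi y)) : multilinear mu ->
  forall w x y z (l : chain (@arr R Q) w (phi x)) (p : chain D x y)
    (r : chain (@arr R Q) (phi y) z),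
  mu _ _ (ccat l (ccat
    (chmap (E2 := @arr R Q) (fun x y e => degsign (hval (h x y e))) p) r)) =
  sg R (rdeg (chmap h p)) *: mu _ _ (ccat l (ccat (cval (chmap h p)) r)).
Proof.
move=> muL w x y z l p r; elim: p l r => [x0|x0 y0 z0 f p IH] l r /=.
  by rewrite /sg scale1r.
rewrite (degsign_homog (@hvalP _ _ _ _ (h _ _ f))) (multilinearZ muL).
rewrite [sg R (_ - 1 + _)]sgD -scalerA; congr (_ *: _).
have E u (s : chain (@arr R Q) (phi y0) u) : ccat l (ccons (hval (h _ _ f)) s) =
    ccat (ccat l (chain1 (hval (h _ _ f) : arr _ _))) s by rewrite -ccatA.
by rewrite E IH -E.
Qed.

End Graded.

(** * The path category of an A-infinity category *)

Section PathCategory.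
Variables (R : comPzRingType) (B : ainfCat R).

Definition invertible (x y : B) (f : arr x y) : Prop :=
  cocycle 0 f /\
  exists g : arr y x,
    [/\ cocycle 0 g,
        cohomologous 0 (am (ccons f (chain1 g))) (aone x)
      & cohomologous 0 (am (ccons g (chain1 f))) (aone y)].

Record hequiv := HEquiv {
  psrc : B; ptgt : B; parr : arr psrc ptgt; parrP : invertible parr
}.

Definition path_quiver : gquiver R := GQuiver (fun o o' : hequiv =>
  triple (qhom (psrc o) (psrc o')) (qhom (ptgt o) (ptgt o'))
    (qhom (psrc o) (ptgt o'))).

Definition arr_src (o o' : path_quiver) (e : arr o o') : arr (psrc o) (psrc o') :=
  e.1.1.
Definition arr_tgt (o o' : path_quiver) (e : arr o o') : arr (ptgt o) (ptgt o') :=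
  e.1.2.
(** The source component, with the sign it takes when standing before the
    crossing. *)
Definition arr_tws (o o' : path_quiver) (e : arr o o') : arr (psrc o) (psrc o') :=
  degsign (arr_src e : qhom _ _).
Definition arr_htp (o o' : path_quiver) (e : arr o o') : arr (psrc o) (ptgt o') :=
  e.2.

(** The off-diagonal entry of the twisted matrix: crossing takes place at an
    object, through its morphism f, or along a single morphism of paths,
    through its homotopy. *)
Definition offdiag (o o' : path_quiver) (p : chain (@arr R path_quiver) o o') :
    arr (psrc o) (ptgt o') :=
  match p in chain _ o o' return arr (psrc o) (ptgt o') with
  | cnil o => parr o
  | ccons o _ _ e p' =>
      match p' in chain _ y z return arr o y -> arr (psrc o) (ptgt z) with
      | cnil _ => fun e => arr_htp e
      | ccons _ _ _ _ _ => fun _ => 0 : qhom _ _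
      end e
  end.

(** All the ways of crossing once from sources to targets along p.  This is the
    part of the differential of the tautological transformation [offdiag],
    from sources to targets, that composes in B. *)
Definition htp_sum (o o' : path_quiver) (p : chain (@arr R path_quiver) o o') :
    qhom (psrc o) (ptgt o') :=
  cut3 p (fun _ _ p1 t p2 => am (ccat
    (chmap arr_tws p1)
    (ccons (offdiag t) (chmap arr_tgt p2))) : qhom (psrc o) (ptgt o')).

(** The minus sign is forced: with it, [offdiag] is a closed transformation,
    and the A-infinity relations hold (see [path_op_rel_htp]). *)
Definition path_op (o o' : path_quiver) (p : chain (@arr R path_quiver) o o') :
    arr o o' :=
  (am (chmap arr_src p) : qhom _ _, am (chmap arr_tgt p) : qhom _ _,
   - htp_sum p).

Definition path_one (o : path_quiver) : arr o o :=
  (aone (psrc o) : qhom _ _, aone (ptgt o) : qhom _ _, 0).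

Let mL := m_linear (ainfCatP B).

Lemma offdiag_mid0 (x y z t : path_quiver) (p : chain (@arr R path_quiver) x y)
    (e : arr y z) (q : chain (@arr R path_quiver) z t) :
  (0 < csize p + csize q)%N ->
  offdiag (ccat p (ccons e q)) = 0 :> qhom (psrc x) (ptgt t).
Proof.
case: p e q => [x0|x0 y0 z0 f p] e q /=; first by case: q e.
by case: p f e => [x1|x1 y1 z1 f' p] f e.
Qed.

(** The middle term is a single one, since [offdiag] vanishes on all chains
    longer than one. *)
Lemma htp_sum_mid (x y z t : path_quiver) (a : chain (@arr R path_quiver) x y)
    (e : arr y z) (c : chain (@arr R path_quiver) z t) :
  htp_sum (ccat a (ccons e c)) =
  cut3 a (fun _ _ a1 d a2 => am (ccat
    (chmap arr_tws a1)
    (ccons (offdiag d) (ccat (chmap arr_tgt a2)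
       (ccons (arr_tgt e) (chmap arr_tgt c))))) : qhom (psrc x) (ptgt t)) +
  am (ccat
    (chmap arr_tws a)
    (ccons (arr_htp e) (chmap arr_tgt c))) +
  cut3 c (fun _ _ c1 d c2 => am (ccat
    (chmap arr_tws a)
    (ccons (arr_tws e) (ccat
      (chmap arr_tws c1)
      (ccons (offdiag d) (chmap arr_tgt c2))))) : qhom (psrc x) (ptgt t)).
Proof.
rewrite /htp_sum cut3_cat; congr (_ + _ + _).
- by apply: eq_cut3 => u v a1 d a2; rewrite chmap_cat.
- rewrite (sum_splits_nilr (fun y a1 a2 => \sum_(u <- splits c) (am (ccat
    (chmap arr_tws a1)
    (ccons (offdiag (ccat a2 (ccons e (cfst u)))) (chmap arr_tgt (csnd u))))
     : qhom (psrc x) (ptgt t)))).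
    rewrite (sum_splits_nil (fun y c1 c2 => am (ccat
      (chmap arr_tws a)
      (ccons (offdiag (ccons e c1)) (chmap arr_tgt c2)))
       : qhom (psrc x) (ptgt t))) // => y0 y1 f c1 c2.
    exact: (multilinear0 mL).
  move=> y0 y1 f a1 a2; apply: big1 => u _.
  by rewrite offdiag_mid0 //; apply: (multilinear0 mL).
- by apply: eq_cut3 => u v c1 d c2; rewrite !chmap_cat -ccatA.
Qed.

Lemma htp_sum_linear : multilinear (Q := path_quiver)
  (W := fun o o' => qhom (psrc o) (ptgt o')) htp_sum.
Proof.
move=> x y z t p a f g q; rewrite !htp_sum_mid.
set S1 := cut3 p _; set S1f := cut3 p _; set S1g := cut3 p _.
have -> : S1 = a *: S1f + S1g.
  rewrite /S1 /S1f /S1g /cut3 scaler_sumr -big_split; apply: eq_bigr => s _ /=.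
  rewrite scaler_sumr -big_split; apply: eq_bigr => u _ /=.
  have E (e : arr y z) : ccat (chmap arr_tws (cfst s))
      (ccons (offdiag (cfst u)) (ccat (chmap arr_tgt (csnd u))
         (ccons (arr_tgt e) (chmap arr_tgt q)))) =
    ccat (ccat (chmap arr_tws (cfst s))
      (ccons (offdiag (cfst u)) (chmap arr_tgt (csnd u))))
         (ccons (arr_tgt e) (chmap arr_tgt q)) by rewrite -ccatA.
  by rewrite !E; apply: mL.
set S3 := cut3 q _; set S3f := cut3 q _; set S3g := cut3 q _.
have -> : S3 = a *: S3f + S3g.
  rewrite /S3 /S3f /S3g /cut3 scaler_sumr -big_split; apply: eq_bigr => s _ /=.
  rewrite scaler_sumr -big_split; apply: eq_bigr => u _ /=.
  by rewrite /arr_tws degsign_linear mL.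
rewrite !scalerDr [RHS]addrACA; congr (_ + _); rewrite [RHS]addrACA.
by congr (_ + _); rewrite -mL.
Qed.

End PathCategory.

Section PathRelation.
Variables (R : comPzRingType) (B : ainfCat R).
Local Notation P := (path_quiver B).
Local Notation hch := (chain (@harr R P)).
Let mL := m_linear (ainfCatP B).
Let m0 := m_nil (ainfCatP B).

Lemma har_src_subproof (o o' : P) (e : harr o o') :
  homog (M := qhom (psrc o) (psrc o')) (hdeg e) (arr_src (hval e)).
Proof. by have /triple_homog[] := hvalP e. Qed.
Definition har_src (o o' : P) (e : harr o o') : harr (psrc o) (psrc o') :=
  HArr (har_src_subproof e).

Lemma har_tgt_subproof (o o' : P) (e : harr o o') :
  homog (M := qhom (ptgt o) (ptgt o')) (hdeg e) (arr_tgt (hval e)).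
Proof. by have /triple_homog[] := hvalP e. Qed.
Definition har_tgt (o o' : P) (e : harr o o') : harr (ptgt o) (ptgt o') :=
  HArr (har_tgt_subproof e).

Lemma har_offdiag_subproof (o o' : P) (p : hch o o') :
  homog (M := qhom (psrc o) (ptgt o')) (rdeg p) (offdiag (cval p)).
Proof.
case: p => [x|x y z e p] /=; first by case: (parrP x) => -[].
case: p e => [x1|x1 y1 z1 f p] e /=; last exact: homog0.
by have /triple_homog[] := hvalP e; rewrite addr0.
Qed.
Definition har_offdiag (o o' : P) (p : hch o o') : harr (psrc o) (ptgt o') :=
  HArr (har_offdiag_subproof p).

(** The string of B whose operation is the summand of [htp_sum] that crosses in
    the middle piece. *)
Definition pstring (o u v o' : P) (p1 : hch o u) (t : hch u v) (p2 : hch v o') :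
    chain (@harr R B) (psrc o) (ptgt o') :=
  ccat (chmap har_src p1) (ccons (har_offdiag t) (chmap har_tgt p2)).

Lemma cval_src (o o' : P) (p : hch o o') :
  chmap (@arr_src _ _) (cval p) = cval (chmap har_src p).
Proof. by rewrite /cval !chmap_comp. Qed.

Lemma cval_tgt (o o' : P) (p : hch o o') :
  chmap (@arr_tgt _ _) (cval p) = cval (chmap har_tgt p).
Proof. by rewrite /cval !chmap_comp. Qed.

Lemma rdeg_src (o o' : P) (p : hch o o') : rdeg (chmap har_src p) = rdeg p.
Proof. by elim: p => //= ? ? ? e p ->. Qed.

Lemma rdeg_tgt (o o' : P) (p : hch o o') : rdeg (chmap har_tgt p) = rdeg p.
Proof. by elim: p => //= ? ? ? e p ->. Qed.

Lemma htp_sum_cval (o o' : P) (p : hch o o') :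
  htp_sum (cval p) = cut3 p (fun _ _ p1 t p2 =>
    sg R (rdeg p1) *: (am (cval (pstring p1 t p2)) : qhom (psrc o) (ptgt o'))).
Proof.
rewrite /htp_sum cut3_chmap; apply: eq_cut3 => u v p1 t p2.
have := chmap_degsign har_src mL (cnil _) p1
  (ccons (hval (har_offdiag t) : arr _ _) (cval (chmap har_tgt p2))).
rewrite rdeg_src /= => E; rewrite /pstring cval_cat -E.
by rewrite /cval !chmap_comp.
Qed.

Lemma path_op_homog (o o' : P) (p : hch o o') :
  homog (M := qhom o o') (rdeg p + 2) (path_op (cval p)).
Proof.
apply/triple_homog; split=> /=.
- by rewrite cval_src -rdeg_src; exact: m_homog (ainfCatP B) _ _ _.
- by rewrite cval_tgt -rdeg_tgt; exact: m_homog (ainfCatP B) _ _ _.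
- rewrite htp_sum_cval -addrA; apply/homogN/cut3_homog => u v a b c.
  apply: homogZ; have := m_homog (ainfCatP B) (pstring a b c).
  by rewrite rdeg_cat /= rdeg_src rdeg_tgt; congr homog; lia.
Qed.

Definition har_path_op (o o' : P) (p : hch o o') : harr o o' :=
  HArr (path_op_homog p).

Definition insert_op (x u v z : B) (l : chain (@harr R B) x u)
    (m : chain (@harr R B) u v) (r : chain (@harr R B) v z) : qhom x z :=
  am (ccat (cval l) (ccons (am (cval m)) (cval r))).

(** The signed form of [htp_sum_mid] on homogeneous morphisms. *)
Lemma htp_sum_cval_mid (o x y o' : P) (u : hch o x) (e : harr x y)
    (w : hch y o') :
  htp_sum (cval (ccat u (ccons e w))) =
  cut3 u (fun _ _ u1 t u2 => sg R (rdeg u1) *: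
    (am (cval (pstring u1 t (ccat u2 (ccons e w)))) : qhom (psrc o) (ptgt o'))) +
  sg R (rdeg u) *: (am (cval (pstring u (chain1 e) w))) +
  cut3 w (fun _ _ w1 t w2 => sg R (rdeg u + hdeg e - 1 + rdeg w1) *:
    (am (cval (pstring (ccat u (ccons e w1)) t w2)) : qhom (psrc o) (ptgt o'))).
Proof.
rewrite htp_sum_cval cut3_cat; congr (_ + _ + _).
- have Z x1 x2 x3 x4 (a : hch o x1) (b : hch x1 x2) e' (c : hch x3 x4) d :
    (0 < csize b + csize c)%N -> sg R (rdeg a) *:
    (am (cval (pstring a (ccat b (ccons e' c)) d)) : qhom (psrc o) (ptgt o')) = 0.
    move=> bc; rewrite /pstring cval_cat cval_cons.
    rewrite [hval _](_ : _ = 0); first by rewrite (multilinear0 mL) scaler0.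
    by rewrite /= cval_cat offdiag_mid0 // /cval !csize_chmap.
  rewrite (sum_splits_nilr (fun y a1 a2 => \sum_(v <- splits w) sg R (rdeg a1) *:
    (am (cval (pstring a1 (ccat a2 (ccons e (cfst v))) (csnd v)))
       : qhom (psrc o) (ptgt o')))).
    rewrite (sum_splits_nil (fun y c1 c2 => sg R (rdeg u) *:
      (am (cval (pstring u (ccons e c1) c2)) : qhom (psrc o) (ptgt o')))) //.
    by move=> y0 y1 f c1 c2; apply: (Z _ _ _ _ u (cnil _)).
  by move=> y0 y1 f a1 a2; apply: big1 => v _; apply: Z.
- apply: eq_cut3 => x1 x2 w1 t w2; congr (sg R _ *: _).
  by rewrite rdeg_cat /=; lia.
Qed.

(** The relation of B at the string that crosses at t, summed over all
    positions of t with the sign of the part before t, splits according to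
    whether the inner operation lies before t, contains t, or lies after t
    (the families K1, K2, K3, indexed by cuts in five).  The relation to be
    proved contains the same three families, each with the opposite sign; for
    K2, where the crossing is inside the inner operation, this uses the minus
    sign in [path_op]. *)
Lemma path_op_rel_htp (o o' : P) (p : hch o o') :
  cut3 p (fun _ _ u v w => sg R (rdeg u) *:
    htp_sum (cval (ccat u (ccons (har_path_op v) w)))) = 0.
Proof.
pose K1 t u v w (a : hch o t) (b : hch t u) (c : hch u v) (d : hch v w)
    (e : hch w o') : qhom (psrc o) (ptgt o') :=
  sg R (rdeg b + rdeg c) *: insert_op (chmap har_src a) (chmap har_src b)
    (pstring c d e).
pose K2 t u v w (a : hch o t) (b : hch t u) (c : hch u v) (d : hch v w)
    (e : hch w o') : qhom (psrc o) (ptgt o') :=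
  sg R (rdeg b) *: insert_op (chmap har_src a) (pstring b c d) (chmap har_tgt e).
pose K3 t u v w (a : hch o t) (b : hch t u) (c : hch u v) (d : hch v w)
    (e : hch w o') : qhom (psrc o) (ptgt o') :=
  sg R (rdeg b + rdeg c + 1) *: insert_op (pstring a b c) (chmap har_tgt d)
    (chmap har_tgt e).
(* The relation of B at all the strings crossing in one piece of p. *)
have relB : cut5 p K1 + cut5 p K2 + cut5 p K3 = 0.
  rewrite -[cut5 p K1]cut3_first -[cut5 p K2]cut3_ends -!cut3D.
  transitivity (cut3 p (fun _ _ _ _ _ => 0 : qhom (psrc o) (ptgt o'))); last first.
    by rewrite /cut3 big1 // => s _; rewrite big1.
  apply: eq_cut3 => x y p1 t p2.
  have := m_rel (ainfCatP B) (pstring p1 t p2).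
  rewrite insertion_sumE; [|exact: mL|exact: m0].
  rewrite -[LHS]/(cut3 (pstring p1 t p2) (fun _ _ l m r =>
     sg R (rdeg l) *: insert_op l m r)) cut3_cat !cut3_chmap.
  move/(congr1 (fun v => sg R (rdeg p1) *: v)); rewrite scaler0 => E.
  rewrite -[RHS]E {E}.
  rewrite !scalerDr; congr (_ + _ + _).
  - rewrite scaler_cut3 (cut3_rdeg p1 (fun k u v a b c => sg R k *:
      (sg R (rdeg (chmap har_src a)) *: (insert_op (chmap har_src a)
         (chmap har_src b) (pstring c t p2) : qhom (psrc o) (ptgt o'))))).
    apply: eq_cut3 => y1 y2 u v w; rewrite rdeg_src scalerA -sgD.
    by congr (_ *: _); apply: (@sg_even R _ _ (- rdeg u)); lia.
  - rewrite (sum_splits_chmap har_src p1 (fun y a b =>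
      \sum_(u <- splits (chmap har_tgt p2)) sg R (rdeg a) *:
        (insert_op a (ccat b (ccons (har_offdiag t) (cfst u))) (csnd u)
           : qhom (psrc o) (ptgt o')))).
    rewrite scaler_sumr (sum_splits_rdeg p1 (fun k y u v => sg R k *:
      \sum_(w <- splits (chmap har_tgt p2)) sg R (rdeg (chmap har_src u)) *:
        (insert_op (chmap har_src u) (ccat (chmap har_src v)
           (ccons (har_offdiag t) (cfst w))) (csnd w) : qhom (psrc o) (ptgt o')))).
    apply: eq_bigr => s _; rewrite (sum_splits_chmap har_tgt p2 (fun y a b =>
      sg R (rdeg (chmap har_src (cfst s))) *: (insert_op (chmap har_src (cfst s))
        (ccat (chmap har_src (csnd s)) (ccons (har_offdiag t) a)) b
          : qhom (psrc o) (ptgt o')))) scaler_sumr.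
    apply: eq_bigr => v _; rewrite rdeg_src scalerA -sgD.
    by congr (_ *: _); apply: (@sg_even R _ _ (- rdeg (cfst s))); lia.
  - rewrite scaler_cut3; apply: eq_cut3 => y1 y2 u v w.
    rewrite scalerA -sgD rdeg_cat /= rdeg_src rdeg_tgt.
    by congr (_ *: _); apply: (@sg_even R _ _ (1 - rdeg p1)); lia.
(* The same cuts, now grouped by the position of the inner operation. *)
transitivity (- (cut5 p K1 + cut5 p K2 + cut5 p K3));
  last by rewrite relB oppr0.
have -> : cut5 p K3 = cut3 p (fun _ _ r d e =>
    cut3 r (fun _ _ a b c => K3 _ _ _ _ a b c d e)) by rewrite cut3_first.
rewrite -[cut5 p K2]cut3_middle [cut5 p K1]/cut5 -!cut3D.
rewrite cut3N; apply: eq_cut3 => x y a b c; rewrite htp_sum_cval_mid !scalerDr.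
set T1 := (X in _ = - (X + _ + _)); set T2 := (X in _ = - (_ + X + _)).
set T3 := (X in _ = - (_ + _ + X)).
rewrite [RHS](_ : _ = - T3 + - T2 + - T1); last first.
  by rewrite -!opprD addrC (addrC T1) addrA.
congr (_ + _ + _); rewrite /T1 /T2 /T3.
- rewrite scaler_cut3 (cut3_rdeg a (fun k _ _ a1 t a2 => sg R k *: (sg R (rdeg a1) *:
    (am (cval (pstring a1 t (ccat a2 (ccons (har_path_op b) c))))
       : qhom (psrc o) (ptgt o'))))) cut3N.
  apply: eq_cut3 => u v a1 t a2; rewrite /K3 scalerA -sgD sgS scaleNr opprK.
  congr (_ *: _); first by apply: (@sg_even R _ _ (rdeg a1)); lia.
  rewrite /insert_op /pstring chmap_cat !(cval_cat, cval_cons) -!ccatA.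
  by rewrite -[cval (chmap har_tgt b)]cval_tgt.
- rewrite scalerA sgK scale1r /pstring cval_cat cval_cons.
  rewrite [hval (har_offdiag _)](_ : _ = - htp_sum (cval b)) //.
  rewrite (multilinearN mL) -cval_tgt -cval_src htp_sum_cval; congr (- _).
  rewrite (multilinear_sum mL); apply: eq_bigr => s _.
  rewrite (multilinear_sum mL); apply: eq_bigr => t _.
  by rewrite (multilinearZ mL) /K2 /insert_op cval_src cval_tgt.
- rewrite scaler_cut3 cut3N; apply: eq_cut3 => u v a1 t a2.
  rewrite scalerA -sgD /K1 -scaleNr -sgS; congr (_ *: _).
    by apply: (@sg_even R _ _ (rdeg a)); rewrite /=; lia.
  rewrite /insert_op /pstring chmap_cat !(cval_cat, cval_cons) -!ccatA.
  by rewrite -[cval (chmap har_src b)]cval_src.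
Qed.

End PathRelation.

Section PathAinf.
Variables (R : comPzRingType) (B : ainfCat R).
Local Notation P := (path_quiver B).
Let mL := m_linear (ainfCatP B).
Let m0 := m_nil (ainfCatP B).

(** The degree of a unit is 0, so its reduced degree is odd. *)
Lemma degsign_one (x : B) : degsign (aone x : qhom x x) = - (aone x : qhom x x).
Proof.
by rewrite (degsign_homog (one_homog (ainfCatP B) x)) sgB1 /sg scaleN1r.
Qed.

Lemma offdiag0 (x y : P) (p : chain (@arr R P) x y) :
  (1 < csize p)%N -> offdiag p = 0 :> qhom (psrc x) (ptgt y).
Proof. by case: p => [//|? ? ? e p]; case: p e => //= ? ? ? f p e. Qed.

Lemma path_op_nil (x : P) : path_op (cnil x) = 0 :> qhom x x.
Proof.
rewrite /path_op /= /htp_sum cut3_nil /= !m0.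
by have [[_ ->] _] := parrP x; rewrite oppr0.
Qed.

Lemma path_op_linear : multilinear (Q := P) (W := @qhom R P) (@path_op R B).
Proof.
move=> x y z t p a f g q; rewrite /path_op htp_sum_linear !chmap_cat /=.
rewrite [X in (X, _, _) = _](mL _ a (arr_src f : qhom _ _) (arr_src g : qhom _ _)).
rewrite [X in (_, X, _) = _](mL _ a (arr_tgt f : qhom _ _) (arr_tgt g : qhom _ _)).
by rewrite opprD -scalerN.
Qed.

Lemma path_op_rel (x z : P) (p : chain (@harr R P) x z) :
  insertion_sum (@path_op R B) (W := @qhom R P) (@path_op R B) p = 0.
Proof.
rewrite insertion_sumE; [|exact: path_op_linear|exact: path_op_nil].
rewrite -[LHS]/(cut3 p (fun u v a b c => sg R (rdeg a) *: (path_op (ccat (cval a)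
  (ccons (path_op (cval b)) (cval c))) : qhom x z))).
set S := cut3 _ _.
have S1 : S.1.1 = 0.
  rewrite /S (cut3_morph _ _ (f := fun v : qhom x z => v.1.1)) //.
  have := m_rel (ainfCatP B) (chmap (@har_src _ _) p).
  rewrite insertion_sumE; [|exact: mL|exact: m0].
  rewrite -[LHS]/(cut3 (chmap (@har_src _ _) p) (fun u v a b c =>
    sg R (rdeg a) *: (am (ccat (cval a) (ccons (am (cval b)) (cval c)))
    : qhom (psrc x) (psrc z)))) cut3_chmap => E; rewrite -[RHS]E.
  apply: eq_cut3 => u v a b c; rewrite rdeg_src -!cval_src /=.
  by rewrite chmap_cat.
have S2 : S.1.2 = 0.
  rewrite /S (cut3_morph _ _ (f := fun v : qhom x z => v.1.2)) //.
  have := m_rel (ainfCatP B) (chmap (@har_tgt _ _) p).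
  rewrite insertion_sumE; [|exact: mL|exact: m0].
  rewrite -[LHS]/(cut3 (chmap (@har_tgt _ _) p) (fun u v a b c =>
    sg R (rdeg a) *: (am (ccat (cval a) (ccons (am (cval b)) (cval c)))
    : qhom (ptgt x) (ptgt z)))) cut3_chmap => E; rewrite -[RHS]E.
  apply: eq_cut3 => u v a b c; rewrite rdeg_tgt -!cval_tgt /=.
  by rewrite chmap_cat.
have S3 : S.2 = 0.
  rewrite /S (cut3_morph _ _ (f := snd)) // -[RHS]oppr0 -[in RHS](path_op_rel_htp p).
  rewrite cut3N; apply: eq_cut3 => u v a b c /=.
  by rewrite scalerN cval_cat.
by move: S1 S2 S3; case: S => -[s1 s2] s3 /= -> -> ->.
Qed.

Lemma path_one_homog (x : P) : homog (M := qhom x x) 0 (path_one x).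
Proof.
by apply/triple_homog; split; rewrite /=;
  [exact: one_homog (ainfCatP B) _ | exact: one_homog (ainfCatP B) _
  | exact: homog0].
Qed.

(** A crossing uses up at most one edge of the chain and adds one argument, so
    each operation of B has at least three arguments, one of them a unit,
    unless the crossing is along the unit, whose homotopy is 0. *)
Lemma path_op_one (x y z : P) (p : chain (@arr R P) x y)
    (q : chain (@arr R P) y z) :
  (2 <= csize p + csize q)%N ->
  path_op (ccat p (ccons (path_one y) q)) = 0 :> qhom x z.
Proof.
move=> pq; have m1 := m_one (ainfCatP B).
rewrite /path_op !chmap_cat /= !m1 ?csize_chmap // htp_sum_mid.
rewrite (multilinear0 mL) addr0 !cut3_eq0 ?addr0 ?oppr0 //.
- move=> u v a b c s; have [b1|b1] := leqP (csize b) 1; last first.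
    rewrite offdiag0 //; have := multilinear0 mL (ccat (chmap (@arr_tws _ _) p)
      (ccons (arr_tws (path_one y)) (chmap (@arr_tws _ _) a)))
      (chmap (@arr_tgt _ _) c).
    by rewrite -ccatA.
  rewrite /arr_tws /= degsign_one (multilinearN mL) m1 ?oppr0 //.
  by rewrite csize_cat /= !csize_chmap; lia.
- move=> u v a b c s; have [b1|b1] := leqP (csize b) 1; last first.
    by rewrite offdiag0 // (multilinear0 mL).
  have := m1 _ _ _ (ccat (chmap (@arr_tws _ _) a) (ccons (offdiag b)
    (chmap (@arr_tgt _ _) c))) (chmap (@arr_tgt _ _) q).
  by rewrite -ccatA; apply; rewrite csize_cat /= !csize_chmap; lia.
Qed.

(** Only the crossing along the homotopy of f, after the unit, survives: the
    crossings at an object give an operation with three arguments.  Its sign, that of a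
    unit, cancels the sign in [path_op]. *)
Lemma path_op_one_source (x y : P) (f : arr x y) :
  path_op (ccons (path_one x) (chain1 f)) = f.
Proof.
have m1 := m_one (ainfCatP B); have o1 := one_source (ainfCatP B).
rewrite /path_op /= !o1; have := htp_sum_mid (cnil x) (path_one x) (chain1 f).
rewrite /= => ->; rewrite cut3_nil cut3_chain1 /= /arr_tws /= degsign_one.
rewrite (m1 _ _ _ (chain1 _) (chain1 _)) //.
rewrite (multilinear0 mL (cnil _)) !add0r.
rewrite !(multilinearN mL (cnil _)) /= o1.
rewrite !(m1 _ _ _ (cnil _) (ccons _ (chain1 _))) // oppr0 add0r addr0 opprK.
by case: f => -[].
Qed.

(** As for [path_op_one_source], except that the homotopy comes first, with no
    sign of its own; but its degree is one less than that of f, which makes up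
    for the sign in [path_op]. *)
Lemma path_op_one_target (x y : P) (f : harr x y) :
  hval f = sg R (hdeg f) *: (path_op (ccons (hval f : arr _ _) (chain1 (path_one y)))
                             : qhom x y).
Proof.
have m1 := m_one (ainfCatP B); have t1 := one_target (ainfCatP B).
rewrite /path_op /=.
have := htp_sum_mid (chain1 (hval f : arr _ _)) (path_one y) (cnil y).
rewrite /= => ->; rewrite cut3_nil cut3_chain1 /=.
rewrite (multilinear0 mL (chain1 _)).
rewrite (m1 _ _ _ (ccons _ (chain1 _)) (cnil _)) //.
rewrite (m1 _ _ _ (ccons _ (chain1 _)) (cnil _)) //.
rewrite /arr_tws /= degsign_one.
rewrite (multilinearN mL (chain1 _)) (m1 _ _ _ (chain1 _) (chain1 _)) //.
rewrite oppr0 !addr0 add0r.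
have Es := t1 _ _ (har_src f); have Et := t1 _ _ (har_tgt f).
have Eh := t1 _ _ (har_offdiag (chain1 f)); rewrite /= addr0 in Es Et Eh.
apply: (@etrans _ _ (hval (har_src f), hval (har_tgt f),
  hval (har_offdiag (chain1 f)))); last first.
  by congr (_, _, _); [exact: Es | exact: Et
    | rewrite scalerN -scaleNr -sgB1; exact: Eh].
by rewrite /arr_src /arr_tgt /=; case: (hval f) => -[].
Qed.

(** The two crossings at the object, before and after its unit, cancel. *)
Lemma path_op_one_closed (x : P) : path_op (chain1 (path_one x)) = 0 :> qhom x x.
Proof.
have m1 := m_one (ainfCatP B); have o1 := one_source (ainfCatP B).
have t1 := one_target (ainfCatP B).
rewrite /path_op /= !(one_closed (ainfCatP B)).
have := htp_sum_mid (cnil x) (path_one x) (cnil x).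
rewrite /= => ->; rewrite !cut3_nil /= /arr_tws /= degsign_one.
rewrite (multilinear0 mL (cnil _)) (multilinearN mL (cnil _)) /= o1 addr0.
have [[p0 _] _] := parrP x; have := t1 _ _ (HArr p0).
by rewrite /= /sg scale1r => <-; rewrite subrr oppr0.
Qed.

Lemma pathCat_is_ainf_cat : is_ainf_cat (@path_op R B) (@path_one R B).
Proof.
split; [exact: path_op_nil | exact: path_op_linear | exact: path_op_homog
  | exact: path_op_rel
  | exact: path_one_homog | exact: path_op_one_closed | exact: path_op_one_source
  | exact: path_op_one_target | exact: path_op_one].
Qed.

Definition pathCat : ainfCat R := AinfCat pathCat_is_ainf_cat.

End PathAinf.

(** * Strict functors, and the ends of a path *)

Section StrictFunctor.
Variables (R : comPzRingType) (A B : ainfCat R).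
Variables (phi : A -> B) (h : forall x y, arr x y -> arr (phi x) (phi y)).
Hypothesis hL : forall (x y : A) a (f g : qhom x y),
  h (a *: f + g : qhom x y) =
  a *: (h f : qhom (phi x) (phi y)) + (h g : qhom (phi x) (phi y))
  :> qhom (phi x) (phi y).
Hypothesis hH : forall (x y : A) d (f : qhom x y),
  homog d f -> homog (M := qhom (phi x) (phi y)) d (h f).
Hypothesis hM : forall (x z : A) (p : chain (@harr R A) x z),
  h (am (cval p)) = am (chmap h (cval p)).
Hypothesis h1 : forall x : A, h (aone x) = aone (phi x).

Definition strict_fmor x z (p : chain (@arr R A) x z) : arr (phi x) (phi z) :=
  h (id_fmor p).

Lemma strict_fun0 x y : h (0 : qhom x y) = 0 :> qhom (phi x) (phi y).
Proof.
have := @hL x y (- 1) 0 0; rewrite scaler0 addr0 => E.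
by rewrite E scaleN1r addNr.
Qed.

Lemma strictD x y (f g : qhom x y) :
  h (f + g : qhom x y) = (h f : qhom (phi x) (phi y)) + h g :> qhom _ _.
Proof. by have := hL 1 f g; rewrite !scale1r. Qed.

Lemma strictZ x y a (f : qhom x y) :
  h (a *: f : qhom x y) = a *: (h f : qhom (phi x) (phi y)) :> qhom _ _.
Proof. by have := hL a f 0; rewrite strict_fun0 !addr0. Qed.

Lemma strict_sum x y (I : Type) (r : seq I) (P : pred I) (f : I -> qhom x y) :
  h (\sum_(i <- r | P i) f i : qhom x y) =
  \sum_(i <- r | P i) (h (f i) : qhom (phi x) (phi y)) :> qhom _ _.
Proof.
exact: (big_morph (fun e : qhom x y => h e : qhom (phi x) (phi y))
  (@strictD x y) (@strict_fun0 x y)).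
Qed.

Lemma strict_linear :
  multilinear (W := fun x z => qhom (phi x) (phi z)) strict_fmor.
Proof.
by move=> x y z t p a f g q; rewrite /strict_fmor -hL -(@id_linear R A).
Qed.

(** Once the linear part commutes with the operations, the functor equation is
    the image of that of the identity functor. *)
Lemma strict_is_ainf_functor : is_ainf_functor strict_fmor.
Proof.
have idP := id_is_ainf_functor A.
split.
- by move=> x; apply: strict_fun0.
- exact: strict_linear.
- by move=> x z p; apply: hH; apply: (fun_homog idP).
- move=> x z p.
  have muL : multilinear (W := fun x z => qhom (phi x) (phi z))
      (fun (x z : A) (p : chain (@arr R A) x z) => am (chmap h p)).
    move=> x' y' z' t' p' a f g q'; rewrite !chmap_cat /=.
    rewrite -(m_linear (ainfCatP B)); congr (am (ccat _ (ccons _ _))).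
    exact: hL.
  have := sum_blocks_id muL (cnil x) (cval p); rewrite /= -hM.
  have -> : am (cval p) =
      \sum_(q <- blocks (cval p)) (am (chmap (phi := id) (@id_fmor R A) q) : qhom x z).
    by rewrite (sum_blocks_id (m_linear (ainfCatP A)) (cnil x) (cval p)).
  rewrite (fun_rel idP) => E.
  transitivity (h (insertion_sum (@am R A) (W := @qhom R A) (@id_fmor R A) p)
    : qhom (phi x) (phi z)).
    by rewrite -E; apply: eq_bigr => q _; rewrite chmap_comp.
  rewrite /insertion_sum strict_sum; apply: eq_bigr => s _.
  by rewrite strict_sum; apply: eq_bigr => t _; rewrite strictZ.
- by move=> x; apply: h1.
- move=> x y z p q pq; rewrite /strict_fmor.
  by rewrite id_fmor_mid0 //; apply: strict_fun0.
Qed.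

Definition strictFun : ainfFun A B := AinfFun strict_is_ainf_functor.

Lemma sum_id_blocks (C : ainfCat R) (F : ainfFun C A) x z
    (p : chain (@arr R C) x z) :
  \sum_(q <- blocks p) (id_fmor (chmap (@fmor _ _ _ F) q) : qhom (F x) (F z)) =
  fmor F p.
Proof.
case: p => [x0|x0 y0 z0 f p].
  by rewrite /= big_seq1 (fun_nil (ainfFunP F)).
rewrite (sum_blocks_head f p (fun q => id_fmor (chmap (@fmor _ _ _ F) q)
  : qhom (F x0) (F z0))).
rewrite (sum_splits_nilr (fun y a b => \sum_(q <- blocks b)
  (id_fmor (chmap (@fmor _ _ _ F) (ccons (ccons f a) q))
     : qhom (F x0) (F z0)))) /=; first by rewrite big_seq1.
move=> y y' g a b; apply: (sum_blocks_nil (fun q =>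
  id_fmor (ccons (fmor F (ccons f a)) (chmap (@fmor _ _ _ F) q))
    : qhom (F x0) (F z0))) => y1 b' q.
exact: id_fmor0.
Qed.

Lemma comp_strict (C : ainfCat R) (F : ainfFun C A) x z
    (p : chain (@arr R C) x z) :
  comp_fmor strictFun F p = h (fmor F p).
Proof. by rewrite -sum_id_blocks strict_sum. Qed.

End StrictFunctor.

Section PathFunctors.
Variables (R : comPzRingType) (B : ainfCat R).
Local Notation P := (pathCat B).

Lemma arr_src_homog (x y : P) d (e : qhom x y) :
  homog d e -> homog (M := qhom (psrc x) (psrc y)) d (arr_src e).
Proof. by case/triple_homog. Qed.

Lemma arr_tgt_homog (x y : P) d (e : qhom x y) :
  homog d e -> homog (M := qhom (ptgt x) (ptgt y)) d (arr_tgt e).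
Proof. by case/triple_homog. Qed.

Definition srcFun : ainfFun P B :=
  @strictFun R P B (@psrc R B) (@arr_src R B) (fun _ _ _ _ _ => erefl)
    arr_src_homog (fun _ _ _ => erefl) (fun _ => erefl).

Definition tgtFun : ainfFun P B :=
  @strictFun R P B (@ptgt R B) (@arr_tgt R B) (fun _ _ _ _ _ => erefl)
    arr_tgt_homog (fun _ _ _ => erefl) (fun _ => erefl).

Lemma cocycle_one (x : B) : cocycle 0 (aone x).
Proof.
by split; [exact: one_homog (ainfCatP B) x | exact: one_closed (ainfCatP B) x].
Qed.

Lemma cohomologous_refl (x y : B) d (f : qhom x y) : cohomologous d f f.
Proof.
exists (0 : qhom x y); first exact: homog0.
by rewrite subrr; apply: (multilinear0 (m_linear (ainfCatP B)) (cnil _)).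
Qed.

Lemma invertible_one (x : B) : invertible (aone x).
Proof.
split; first exact: cocycle_one.
have o1 := one_source (ainfCatP B).
exists (aone x); split; rewrite ?o1; try exact: cohomologous_refl.
exact: cocycle_one.
Qed.

Definition const_hequiv (x : B) : P := HEquiv (invertible_one x).

Definition const_arr (x y : B) (f : arr x y) :
    arr (const_hequiv x) (const_hequiv y) :=
  (f : qhom x y, f : qhom x y, 0 : qhom x y).

(** As the homotopies are zero, all crossings are through units of B.  They
    vanish by strict unitality in chains of length at least two, and because
    units are closed in the empty chain; in length one, the crossings before
    and after the only edge cancel. *)
Lemma const_htp_sum (x z : B) (p : chain (@harr R B) x z) :
  htp_sum (chmap const_arr (cval p)) = 0.
Proof.
have mL := m_linear (ainfCatP B); have m1 := m_one (ainfCatP B).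
have o1 := one_source (ainfCatP B).
have ca (u v : B) (a : chain (@harr R B) u v) :
  csize (chmap (@arr_tws R B) (chmap const_arr (cval a))) = csize a.
  by rewrite !csize_chmap.
have ct (u v : B) (a : chain (@harr R B) u v) :
  csize (chmap (@arr_tgt R B) (chmap const_arr (cval a))) = csize a.
  by rewrite !csize_chmap.
rewrite /htp_sum !cut3_chmap.
have [p1|] := leqP 2 (csize p).
  apply: cut3_eq0 => u v a b c s; case: b a c s => [y|y y' y'' f b] a c s /=.
    rewrite m1 //; move: (ca _ _ a) (ct _ _ c); rewrite /cval /= => -> ->.
    by rewrite /= addn0 in s; rewrite s.
  by case: b f c s => [y1|y1 y2 y3 g b] f c s /=; rewrite (multilinear0 mL).
case: p => [x0|x0 y0 z0 f p] /=.
  by rewrite cut3_nil /= (one_closed (ainfCatP B)).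
case: p f => [y1|y1 y2 y3 g p] f // _; rewrite cut3_chain1 /=.
rewrite (multilinear0 mL (cnil _)) addr0 o1.
rewrite /arr_tws (degsign_homog (hvalP f)) (multilinearZ mL (cnil _)) /=.
by rewrite sgB1 scaleNr -(one_target (ainfCatP B)) subrr.
Qed.

Lemma const_arr_linear (x y : B) a (f g : qhom x y) :
  const_arr (a *: f + g : qhom x y) =
  a *: (const_arr f : qhom (const_hequiv x) (const_hequiv y)) + const_arr g
  :> qhom (const_hequiv x) (const_hequiv y).
Proof.
have E : (0 : qhom x y) = a *: 0 + 0 by rewrite scaler0 addr0.
exact: (congr1 (fun v : qhom x y => (a *: f + g, a *: f + g, v)) E).
Qed.

Lemma const_arr_homog (x y : B) d (f : qhom x y) : homog d f ->
  homog (M := qhom (const_hequiv x) (const_hequiv y)) d (const_arr f).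
Proof. by move=> fd; apply/triple_homog; split=> //; apply: homog0. Qed.

Lemma const_arr_op (x z : B) (p : chain (@harr R B) x z) :
  const_arr (am (cval p)) = am (chmap const_arr (cval p)).
Proof.
have E (w y : B) (q : chain (@arr R B) w y) :
    chmap (@arr_src R B) (chmap const_arr q) = q /\
    chmap (@arr_tgt R B) (chmap const_arr q) = q.
  elim: q => // ? ? ? f q [E1 E2].
  by split; [exact: (congr1 (ccons f) E1) | exact: (congr1 (ccons f) E2)].
have [E1 E2] := E _ _ (cval p).
rewrite /= /path_op const_htp_sum oppr0.
by rewrite [X in (am X, _, _)]E1 [X in (_, am X, _)]E2.
Qed.

Definition constFun : ainfFun B P :=
  @strictFun R B P const_hequiv const_arr const_arr_linear const_arr_homog
    const_arr_op (fun _ => erefl).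

End PathFunctors.

(** * The functor into paths given by a closed transformation *)

Section HomotopyFunctor.
Variables (R : comPzRingType) (A B : ainfCat R) (F G : ainfFun A B).
Variable T : prenatural F G 0.
Hypothesis T_closed : nat_closed T.
Hypothesis T_inv : forall x : A, invertible (T _ _ (cnil x)).
Local Notation P := (pathCat B).

Let FP := ainfFunP F.
Let GP := ainfFunP G.
Let TP := prenaturalP T.
Let mL := m_linear (ainfCatP B).

Definition nat_hequiv (x : A) : P := HEquiv (T_inv x).

(** The value of T on empty chains gives the objects; a functor has to vanish
    there. *)
Definition nat_htp (x z : A) (p : chain (@arr R A) x z) : qhom (F x) (G z) :=
  if csize p == 0%N then 0 else T _ _ p.

Definition nat_fmor (x z : A) (p : chain (@arr R A) x z) :
    arr (nat_hequiv x) (nat_hequiv z) :=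
  (fmor F p : qhom _ _, fmor G p : qhom _ _, nat_htp p).

Lemma nat_htp_mid (x y z t : A) (p : chain (@arr R A) x y) (e : arr y z)
    (q : chain (@arr R A) z t) :
  nat_htp (ccat p (ccons e q)) = T _ _ (ccat p (ccons e q)).
Proof. by rewrite /nat_htp csize_cat addnS. Qed.

(** Only the trivial decomposition, in at most one block, contributes. *)
Lemma sum_blocks_offdiag (x z : A) (p : chain (@arr R A) x z) :
  \sum_(q <- blocks p) (offdiag (chmap nat_fmor q) : qhom (F x) (G z)) = T _ _ p.
Proof.
case: p => [x0|x0 y0 z0 f p]; first by rewrite /= big_seq1.
rewrite (sum_blocks_head f p (fun q => offdiag (chmap nat_fmor q)
  : qhom (F x0) (G z0))).
rewrite (sum_splits_nilr (fun y a b => \sum_(q <- blocks b)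
  (offdiag (chmap nat_fmor (ccons (ccons f a) q)) : qhom (F x0) (G z0)))).
  by rewrite /= big_seq1.
move=> y y' g a b; apply: (sum_blocks_nil (fun q => offdiag (chmap nat_fmor
  (ccons (ccons f a) q)) : qhom (F x0) (G z0))) => y1 b' q.
by [].
Qed.

(** The part of the differential of T that composes in B. *)
Definition M1_operation (x z : A) (p : chain (@harr R A) x z) :
    qhom (F x) (G z) :=
  cut3 p (fun _ _ a b c =>
    \sum_(q1 <- blocks (cval a)) \sum_(q2 <- blocks (cval c))
      sg R ((0 - 1) * rdeg a) *:
        (am (ccat (chmap (@fmor _ _ _ F) q1)
          (ccons (T _ _ (cval b)) (chmap (@fmor _ _ _ G) q2)))
         : qhom (F x) (G z))).

Lemma sum_blocks_htp_sum (x z : A) (p : chain (@harr R A) x z) :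
  \sum_(q <- blocks (cval p)) htp_sum (chmap nat_fmor q) = M1_operation p.
Proof.
rewrite blocks_cval big_map.
pose phi u v (a : chain (chain (@harr R A)) x u) (b : chain (chain (@harr R A)) u v)
   (c : chain (chain (@harr R A)) v z) : qhom (F x) (G z) :=
  sg R (brdeg a) *: (am (ccat (chmap (fun _ _ b => fmor F (cval b)) a)
    (ccons (offdiag (chmap nat_fmor (chmap (phi := id) (@cval R A) b)))
       (chmap (@fmor _ _ _ G) (chmap (phi := id) (@cval R A) c))))
    : qhom (F x) (G z)).
transitivity (\sum_(q <- blocks p) cut3 q phi).
  apply: eq_bigr => q _; rewrite /htp_sum !cut3_chmap.
  apply: eq_cut3 => u v a b c; rewrite /phi -(rdeg_chmap F) -(cval_chmap F).
  rewrite !chmap_comp.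
  exact: (chmap_degsign (fharr F) mL (cnil _)).
rewrite sum_blocks_cut3; apply: eq_cut3 => u v a b c.
rewrite /phi (sum_blocks_brdeg a (fun k q1 => \sum_(q2 <- blocks b)
  \sum_(q3 <- blocks c) sg R k *: (am (ccat (chmap (fun _ _ b => fmor F (cval b)) q1)
    (ccons (offdiag (chmap nat_fmor (chmap (phi := id) (@cval R A) q2)))
       (chmap (@fmor _ _ _ G) (chmap (phi := id) (@cval R A) q3))))
    : qhom (F x) (G z)))).
rewrite [in RHS]blocks_cval big_map; apply: eq_bigr => q1 _.
rewrite exchange_big [in RHS]blocks_cval big_map; apply: eq_bigr => q3 _.
rewrite -scaler_sumr sub0r mulN1r sgN; congr (_ *: _).
rewrite -(multilinear_sum mL) -sum_blocks_offdiag (chmap_fmor_cval F).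
by rewrite [in RHS]blocks_cval big_map.
Qed.

(** This is the closedness of T. *)
Lemma nat_insertion (x z : A) (p : chain (@harr R A) x z) :
  insertion_sum (@am R A) (W := fun x z => qhom (F x) (G z)) T p =
  - M1_operation p.
Proof.
have := T_closed p; rewrite /M1 -/(M1_operation p) sub0r sgN /sg /= expr1.
rewrite scaleN1r opprK => /eqP; rewrite addrC addr_eq0 => /eqP ->.
by [].
Qed.

Lemma nat_is_ainf_functor : is_ainf_functor nat_fmor.
Proof.
split.
- by move=> x; rewrite /nat_fmor (fun_nil FP) (fun_nil GP).
- move=> x y z t p a f g q.
  rewrite /nat_fmor !nat_htp_mid (fun_linear FP) (fun_linear GP) (nat_linear TP).
  by [].
- move=> x z p; apply/triple_homog; split=> /=; [exact: fun_homog FP _ _ _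
    | exact: fun_homog GP _ _ _ |].
  rewrite addrK /nat_htp; case: ifP => _; first exact: homog0.
  by have := nat_homog TP p; rewrite addr0.
- move=> x z p.
  set L := LHS; set K := RHS.
  have E1 : L.1.1 = K.1.1.
    rewrite /L (big_morph (fun v : qhom (nat_hequiv x) (nat_hequiv z) => v.1.1)
       (id1 := 0) (op1 := +%R)) //.
    transitivity (\sum_(q <- blocks (cval p)) (am (chmap (@fmor _ _ _ F) q)
      : qhom (F x) (F z))).
      by apply: eq_bigr => q _; rewrite /= chmap_comp.
    rewrite (fun_rel FP) /K /insertion_sum.
    rewrite (big_morph (fun v : qhom (nat_hequiv x) (nat_hequiv z) => v.1.1)
       (id1 := 0) (op1 := +%R)) //; apply: eq_bigr => s _.
    by rewrite (big_morph (fun v : qhom (nat_hequiv x) (nat_hequiv z) => v.1.1)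
       (id1 := 0) (op1 := +%R)).
  have E2 : L.1.2 = K.1.2.
    rewrite /L (big_morph (fun v : qhom (nat_hequiv x) (nat_hequiv z) => v.1.2)
       (id1 := 0) (op1 := +%R)) //.
    transitivity (\sum_(q <- blocks (cval p)) (am (chmap (@fmor _ _ _ G) q)
      : qhom (G x) (G z))).
      by apply: eq_bigr => q _; rewrite /= chmap_comp.
    rewrite (fun_rel GP) /K /insertion_sum.
    rewrite (big_morph (fun v : qhom (nat_hequiv x) (nat_hequiv z) => v.1.2)
       (id1 := 0) (op1 := +%R)) //; apply: eq_bigr => s _.
    by rewrite (big_morph (fun v : qhom (nat_hequiv x) (nat_hequiv z) => v.1.2)
       (id1 := 0) (op1 := +%R)).
  have E3 : L.2 = K.2.
    rewrite /L (big_morph (fun v : qhom (nat_hequiv x) (nat_hequiv z) => v.2)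
       (id1 := 0) (op1 := +%R)) //.
    transitivity (- M1_operation p); first by rewrite -sum_blocks_htp_sum -sumrN.
    rewrite -nat_insertion /K /insertion_sum.
    rewrite (big_morph (fun v : qhom (nat_hequiv x) (nat_hequiv z) => v.2)
       (id1 := 0) (op1 := +%R)) //; apply: eq_bigr => s _.
    rewrite (big_morph (fun v : qhom (nat_hequiv x) (nat_hequiv z) => v.2)
       (id1 := 0) (op1 := +%R)) //; apply: eq_bigr => t _.
    by rewrite -nat_htp_mid.
  move: E1 E2 E3; case: L => -[l1 l2] l3; case: K => -[k1 k2] k3 /=.
  by move=> -> -> ->.
- move=> x; rewrite /nat_fmor (fun_one FP) (fun_one GP).
  have := nat_htp_mid (cnil x) (aone x) (cnil x); rewrite /= => ->.
  by have := nat_ones TP (cnil x) (cnil x); rewrite /= => ->.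
- move=> x y z p q pq; rewrite /nat_fmor (fun_ones FP) // (fun_ones GP) //.
  by rewrite nat_htp_mid (nat_ones TP).
Qed.

Definition natFun : ainfFun A P := AinfFun nat_is_ainf_functor.

End HomotopyFunctor.

(** * Composition with an invertible morphism, in cohomology *)

Section Cohomology.
Variables (R : comPzRingType) (B : ainfCat R).
Let mL := m_linear (ainfCatP B).

Lemma m_chain1D (x y : B) (f g : qhom x y) :
  am (chain1 (f + g : arr x y)) =
  (am (chain1 (f : arr x y)) : qhom x y) + am (chain1 (g : arr x y)) :> qhom x y.
Proof. exact: (multilinearD mL (cnil x) f g (cnil y)). Qed.

Lemma m_chain1N (x y : B) (f : qhom x y) :
  am (chain1 (- f : arr x y)) = - (am (chain1 (f : arr x y)) : qhom x y)
  :> qhom x y.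
Proof. exact: (multilinearN mL (cnil x) f (cnil y)). Qed.

Lemma m_rel2 (x y z : B) (f : harr x y) (g : harr y z) :
  am (ccons (am (chain1 (hval f : arr _ _))) (chain1 (hval g : arr _ _))) +
  sg R (hdeg f - 1) *:
    (am (ccons (hval f : arr _ _) (chain1 (am (chain1 (hval g : arr _ _)))))
      : qhom x z) +
  am (chain1 (am (ccons (hval f : arr _ _) (chain1 (hval g : arr _ _))))) = 0
  :> qhom x z.
Proof.
have := m_rel (ainfCatP B) (ccons f (chain1 g)).
rewrite /insertion_sum /cval /= !(big_cons, big_nil) /= !(addr0, add0r).
by rewrite /sg expr0 !scale1r addrAC.
Qed.

(** Composition of cocycles is associative up to the boundary of the ternary
    operation. *)
Lemma m_rel3 (x y z t : B) (f : harr x y) (g : harr y z) (h : harr z t) :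
  cocycle (hdeg f) (hval f) -> cocycle (hdeg g) (hval g) ->
  cocycle (hdeg h) (hval h) ->
  am (ccons (am (ccons (hval f : arr _ _) (chain1 (hval g : arr _ _))))
        (chain1 (hval h : arr _ _))) +
  sg R (hdeg f - 1) *: (am (ccons (hval f : arr _ _)
    (chain1 (am (ccons (hval g : arr _ _) (chain1 (hval h : arr _ _))))))
      : qhom x t) +
  am (chain1 (am (ccons (hval f : arr _ _)
    (ccons (hval g : arr _ _) (chain1 (hval h : arr _ _)))))) = 0
  :> qhom x t.
Proof.
move=> [_ fc] [_ gc] [_ hc].
have := m_rel (ainfCatP B) (ccons f (ccons g (chain1 h))).
rewrite /insertion_sum /cval /= !(big_cons, big_nil) /= !(addr0, add0r).
rewrite fc gc hc (multilinear0 mL (cnil _)) (multilinear0 mL (chain1 _)).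
rewrite (multilinear0 mL (ccons _ (chain1 _))) !scaler0 !(addr0, add0r).
by rewrite /sg expr0 !scale1r addrAC.
Qed.

(** The correcting homotopies are the ternary operation, for associativity, and
    the composite of k with h, where k compares the composite of f and g with
    the unit. *)
Lemma inverse_act (x y z : B) (f : arr x y) (g : arr y x) d (h : arr x z) :
  cocycle 0 f -> cocycle 0 g -> cocycle d h ->
  cohomologous 0 (am (ccons f (chain1 g))) (aone x) ->
  cohomologous d (am (ccons f (chain1 (am (ccons g (chain1 h)))))) h.
Proof.
move=> fc gc hc [k kh kE].
have [[[fH _] [gH _]] [hH hm]] := (fc, gc, hc).
have /= r3 := @m_rel3 _ _ _ _ (HArr fH) (HArr gH) (HArr hH) fc gc hc.
have /= r2 := m_rel2 (HArr kh) (HArr hH).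
rewrite hm kE (multilinear0 mL (chain1 _)) scaler0 addr0 in r2.
move: r2; rewrite (multilinearD mL (cnil x)) (multilinearN mL (cnil x)) /=.
rewrite (one_source (ainfCatP B)) => r2.
exists ((am (ccons f (ccons g (chain1 h))) : qhom x z)
  - (am (ccons k (chain1 h)) : qhom x z)).
  apply: homogD; last apply: homogN.
    have := m_homog (ainfCatP B) (ccons (HArr fH) (ccons (HArr gH)
      (chain1 (HArr hH)))).
    by rewrite /=; congr homog; lia.
  have := m_homog (ainfCatP B) (ccons (HArr kh) (chain1 (HArr hH))).
  by rewrite /=; congr homog; lia.
rewrite m_chain1D m_chain1N.
move: r3 r2 => /eqP; rewrite addrC addr_eq0 => /eqP -> /eqP.
rewrite addrC addr_eq0 => /eqP ->.
by rewrite sgB1 scaleN1r !opprB addrA subrK.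
Qed.

Lemma precomp_inj (x y z : B) (f : arr x y) d (b : arr y z) (w : arr x z) :
  invertible f -> cocycle d b -> homog (M := qhom x z) (d - 1) w ->
  am (chain1 w) = am (ccons f (chain1 b)) :> qhom x z ->
  exists2 v : arr y z, homog (M := qhom y z) (d - 1) v &
    am (chain1 v) = b :> qhom y z.
Proof.
move=> [fc [g [gc _ gf]]] bc wH wE.
have [s sH sE] := inverse_act gc fc bc gf.
have [gH gm] := gc.
have /= r2 := m_rel2 (HArr gH) (HArr wH).
move: r2; rewrite gm (multilinear0 mL (cnil _)) add0r sgB1 scaleN1r wE.
move=> /eqP; rewrite addrC subr_eq0 => /eqP r2.
exists ((am (ccons g (chain1 w)) : qhom y z) - (s : qhom y z)).
  apply: homogD; last exact: homogN.
  have := m_homog (ainfCatP B) (ccons (HArr gH) (chain1 (HArr wH))).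
  by rewrite /=; congr homog; lia.
by rewrite m_chain1D m_chain1N r2 sE opprB addrCA subrr addr0.
Qed.

Lemma precomp_surj (x y z : B) (f : arr x y) d (c : arr x z) :
  invertible f -> cocycle d c ->
  exists2 b : arr y z, cocycle d b & cohomologous d (am (ccons f (chain1 b))) c.
Proof.
move=> [fc [g [gc fg _]]] cc; exists (am (ccons g (chain1 c))); last first.
  exact: inverse_act fc gc cc fg.
have [[gH gm] [cH cm]] := (gc, cc); split.
  have := m_homog (ainfCatP B) (ccons (HArr gH) (chain1 (HArr cH))).
  by rewrite /=; congr homog; lia.
have /= := m_rel2 (HArr gH) (HArr cH).
by rewrite gm cm (multilinear0 mL (cnil _)) (multilinear0 mL (chain1 _))
  scaler0 !add0r.
Qed.

End Cohomology.

(** * The source functor is a quasi-equivalence *)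

Section SrcQuasiEquivalence.
Variables (R : comPzRingType) (B : ainfCat R).
Local Notation P := (pathCat B).
Let mL := m_linear (ainfCatP B).

Lemma htp_sum_chain1 (x y : P) (e : arr x y) :
  htp_sum (chain1 e) =
  (am (ccons (parr x) (chain1 (arr_tgt e))) : qhom (psrc x) (ptgt y)) +
  am (chain1 (arr_htp e)) +
  am (ccons (degsign (arr_src e : qhom _ _) : arr _ _) (chain1 (parr y))).
Proof. by rewrite /htp_sum cut3_chain1. Qed.

(** The Leibniz rule for composing with a cocycle on the target side; the
    linear sign operator absorbs the sign of the rule. *)
Lemma m_twist (x y z : B) d (u : arr x y) (f : arr y z) :
  homog (M := qhom x y) d u -> cocycle 0 f ->
  am (chain1 (am (ccons (degsign (u : qhom x y) : arr x y) (chain1 f)))) =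
  am (ccons (degsign (am (chain1 u) : qhom x y) : arr x y) (chain1 f)) :> qhom x z.
Proof.
move=> uH [fH fm].
have mu : homog (M := qhom x y) (d + 1) (am (chain1 u)).
  have := m_homog (ainfCatP B) (chain1 (HArr uH)).
  by rewrite /=; congr homog; lia.
rewrite (degsign_homog uH) (degsign_homog mu) !(multilinearZ mL (cnil _)) /=.
have /= := m_rel2 (HArr uH) (HArr fH); rewrite fm (multilinear0 mL (chain1 _)).
rewrite scaler0 addr0 => /eqP; rewrite addrC addr_eq0 => /eqP ->.
by rewrite addrK sgB1 scalerN scaleNr opprK.
Qed.

Lemma twist_homog (x y z : B) d (u : arr x y) (f : arr y z) :
  homog (M := qhom x y) d u -> cocycle 0 f ->
  homog (M := qhom x z) d (am (ccons (degsign (u : qhom x y) : arr x y) (chain1 f))).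
Proof.
move=> uH [fH _]; rewrite (degsign_homog uH) (multilinearZ mL (cnil _)) /=.
apply: homogZ; have := m_homog (ainfCatP B) (ccons (HArr uH) (chain1 (HArr fH))).
by rewrite /=; congr homog; lia.
Qed.

(** A diagram chase in the cone of composition with f, the morphism of the
    source object.

    Injectivity: given a cocycle (a, b, h) whose source component is the
    boundary of u, subtracting the boundary of (u, 0, 0) replaces it by
    (0, b, h') with the composite of f and b bounded by - h'.  As composition
    with f is injective in cohomology, b is the boundary of some v, and h' plus
    the composite of f and v is a cocycle; as composition with f is surjective
    in cohomology, this cocycle is, up to the boundary of some k, the composite
    of f with a cocycle w.  Then (u, v - w, k) has the required boundary.

    Surjectivity: a cocycle a, composed with the morphism of the target object,
    is up to sign and to a boundary the composite of f with a cocycle b. *)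
Lemma srcFun_quasi_iso : quasi_isomorphic_on_homs (srcFun B).
Proof.
move=> x y d; split=> [e1 e2 [H1 c1] [H2 c2] [u uH uE]|a [aH am0]].
- pose e : qhom x y := (e1 : qhom x y) - e2.
  have [_ bH hH] : [/\ homog d e.1.1, homog d e.1.2 & homog (d - 1) e.2].
    by apply/triple_homog/homogD => //; apply: homogN.
  have eE : am (chain1 (e : arr x y)) = 0 :> qhom x y.
    by rewrite /e m_chain1D m_chain1N c1 c2 subr0.
  have bE : am (chain1 (e.1.2 : arr (ptgt x) (ptgt y))) = 0
    :> qhom (ptgt x) (ptgt y) by exact: (congr1 (fun v => v.1.2) eE).
  have hE : htp_sum (chain1 (e : arr x y)) = 0.
    by apply: oppr_inj; rewrite oppr0; exact: (congr1 snd eE).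
  rewrite htp_sum_chain1 in hE.
  have aE : e.1.1 = am (chain1 u) by rewrite uE.
  rewrite /arr_src aE -(m_twist uH (proj1 (parrP y))) in hE.
  have [[[fH fm] _] [f'H f'm]] := (parrP x, proj1 (parrP y)).
  pose h' : qhom (psrc x) (ptgt y) := e.2 +
    am (ccons (degsign (u : qhom _ _) : arr _ _) (chain1 (parr y))).
  have h'H : homog (d - 1) h'.
    by apply: homogD => //; apply: twist_homog => //; case: (parrP y).
  have h'E : am (ccons (parr x) (chain1 (e.1.2 : arr (ptgt x) (ptgt y)))) =
    - (am (chain1 (h' : arr _ _)) : qhom (psrc x) (ptgt y)) :> qhom _ _.
    by apply/eqP; rewrite -addr_eq0 /h' m_chain1D addrA hE.
  have [v vH vE] : exists2 v : arr (ptgt x) (ptgt y),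
    homog (M := qhom (ptgt x) (ptgt y)) (d - 1) v &
    am (chain1 v) = e.1.2 :> qhom (ptgt x) (ptgt y).
    apply: (precomp_inj (parrP x) (w := - h')) => //; first exact: homogN.
    by rewrite m_chain1N h'E.
  pose fv : qhom (psrc x) (ptgt y) := am (ccons (parr x) (chain1 v)).
  have [w [wH wm] [k kH kE]] : exists2 w : arr (ptgt x) (ptgt y), cocycle (d - 1) w &
    cohomologous (d - 1) (am (ccons (parr x) (chain1 w))) (h' + fv).
    apply: precomp_surj (parrP x) _; split.
      apply: homogD => //.
      have := m_homog (ainfCatP B) (ccons (HArr fH) (chain1 (HArr vH))).
      by rewrite /=; congr homog; lia.
    rewrite m_chain1D; have /= := m_rel2 (HArr fH) (HArr vH).
    rewrite fm (multilinear0 mL (cnil _)) add0r sgB1 scaleN1r vE h'E opprK.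
    by [].
  exists (u : qhom _ _, (v : qhom _ _) - w, k : qhom _ _).
    apply/triple_homog; split=> //=.
    by apply: homogD => //; apply: homogN.
  rewrite -[RHS]/e.
  have E : am (ccons (parr x) (chain1 ((v : qhom _ _) - (w : qhom _ _) : arr _ _))) =
    fv - am (ccons (parr x) (chain1 w)) :> qhom (psrc x) (ptgt y).
    by rewrite (multilinearD mL (chain1 _)) (multilinearN mL (chain1 _)).
  apply: (@etrans _ _ (e.1.1, e.1.2, e.2)); last by case: (e) => -[].
  rewrite /= /path_op htp_sum_chain1; congr (_, _, _); first exact: esym aE.
    rewrite -[LHS]/(am (chain1 ((v : qhom _ _) - (w : qhom _ _) : arr _ _))
      : qhom _ _).
    by rewrite m_chain1D m_chain1N vE wm subr0.
  rewrite /arr_tgt /arr_htp /arr_src /= E kE.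
  rewrite [X in - (X + _)](_ : _ = - h'); last first.
    by rewrite addrA subrK opprD addrCA subrr addr0.
  rewrite opprD opprK.
  by rewrite -[RHS]/e.2 /h' addrK.
- have [[f'H f'm]] := proj1 (parrP y).
  pose c : qhom (psrc x) (ptgt y) :=
    - (am (ccons (degsign (a : qhom _ _) : arr _ _) (chain1 (parr y)))
       : qhom (psrc x) (ptgt y)).
  have [b [bH bm] [k kH kE]] : exists2 b : arr (ptgt x) (ptgt y), cocycle d b &
    cohomologous d (am (ccons (parr x) (chain1 b))) c.
    have f'P := proj1 (parrP y).
    apply: precomp_surj (parrP x) _; split; first exact/homogN/twist_homog.
    rewrite /c m_chain1N (m_twist aH) // am0 (degsign_homog (homog0 _ 0)) scaler0.
    by rewrite (multilinear0 mL (cnil _)) oppr0.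
  exists (a : qhom _ _, b : qhom _ _, - (k : qhom _ _)).
    split.
      apply/triple_homog; split=> //=; exact: homogN.
    rewrite /= /path_op htp_sum_chain1 /= /arr_tgt /arr_htp /arr_src /= m_chain1N kE.
    rewrite opprB addrCA subrr addr0 /c addNr oppr0.
    by rewrite -[ccons a _]/(chain1 a) -[ccons b _]/(chain1 b) am0 bm.
  exact: cohomologous_refl.
Qed.

Lemma srcFun_quasi_equivalence : quasi_equivalence (srcFun B).
Proof.
split; first exact: srcFun_quasi_iso.
move=> y; exists (const_hequiv y); exists (aone y), (aone y).
have o1 := one_source (ainfCatP B).
split; rewrite ?o1; [exact: cocycle_one | exact: cocycle_one
  | exact: cohomologous_refl | exact: cohomologous_refl].
Qed.

Lemma srcFun_const : acomp (srcFun B) (constFun B) = aid B.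
Proof.
by apply: ainfFun_eq => x z p; apply: comp_strict.
Qed.

Lemma tgtFun_const : acomp (tgtFun B) (constFun B) = aid B.
Proof.
by apply: ainfFun_eq => x z p; apply: comp_strict.
Qed.

Lemma ho_class_comp (A1 A2 A3 : ainfCat R) (K : ainfFun A2 A3)
    (L : ainfFun A1 A2) :
  ho_class (acomp K L) =
  @ccomp (HoAinfCats R) A1 A2 A3 (ho_class K) (ho_class L).
Proof. exact: loc_comp. Qed.

(** As a section of a quasi-equivalence, [constFun] becomes its two-sided
    inverse in the localization; it is also a section of [tgtFun]. *)
Lemma ho_srcFun_tgtFun : ho_class (srcFun B) = ho_class (tgtFun B).
Proof.
have [v [vs _]] := loc_inv (C := AinfCats R) (W := @quasi_equivalence R)
  srcFun_quasi_equivalence.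
pose C := HoAinfCats R.
have vE : ho_class (constFun B) = v.
  rewrite -[LHS](@ccomp_idl C) -vs -(@ccompA C) -ho_class_comp srcFun_const.
  by rewrite [ho_class (aid B)]loc_id (@ccomp_idr C).
have cs : @ccomp C P B P (ho_class (constFun B)) (ho_class (srcFun B)) =
  @cidm C P by rewrite vE.
rewrite -[RHS](@ccomp_idr C) -cs (@ccompA C) -ho_class_comp tgtFun_const.
by rewrite [ho_class (aid B)]loc_id (@ccomp_idl C).
Qed.

End SrcQuasiEquivalence.

(** * Weakly equivalent functors *)

Lemma M1_nil (R : comPzRingType) (A B : ainfCat R) (F G : ainfFun A B) g
    (T : prenatural F G g) (x : A) :
  M1 T (cnil x) = am (chain1 (T _ _ (cnil x))).
Proof.
rewrite /M1 /insertion_sum /= !big_seq1 /= big_cons big_nil /= scaler0 subr0.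
by rewrite mulr0 /sg expr0 scale1r.
Qed.

Lemma M2_nil (R : comPzRingType) (A B : ainfCat R) (F G K : ainfFun A B) g2 g1
    (T2 : prenatural G K g2) (T1 : prenatural F G g1) (x : A) :
  M2 T2 T1 (cnil x) = am (ccons (T1 _ _ (cnil x)) (chain1 (T2 _ _ (cnil x)))).
Proof.
by rewrite /M2 /= !big_seq1 /= !mulr0 /sg expr0 scale1r.
Qed.

(** The inverse of T^0(x) in H^0 is S^0(x): on empty chains the two homotopy
    equations say that their composites are homotopic to units. *)
Lemma weakly_equivalent_invertible (R : comPzRingType) (A B : ainfCat R)
    (F G : ainfFun A B) : weakly_equivalent F G ->
  exists T : prenatural F G 0, nat_closed T /\
    forall x : A, invertible (T _ _ (cnil x)).
Proof.
move=> [T [S [H [H' [Tc Sc TS ST]]]]]; exists T; split=> // x.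
have cocycle_nil (K L : ainfFun A B) (U : prenatural K L 0) :
    nat_closed U -> cocycle 0 (U _ _ (cnil x)).
  move=> Uc; split; last by rewrite -M1_nil Uc.
  by have := nat_homog (prenaturalP U) (cnil x).
have cohomologous_nil (K : ainfFun A B) (U : prenatural K K (-1)) (w : qhom _ _) :
    w = Id_tr K (cnil x) + M1 U (cnil x) -> cohomologous 0 w (aone (K x)).
  move=> ->; rewrite M1_nil; exists (U _ _ (cnil x)).
    by have := nat_homog (prenaturalP U) (cnil x).
  by rewrite /= addrC addKr.
split; first exact: cocycle_nil; exists (S _ _ (cnil x)).
by split; [exact: cocycle_nil
  | apply: (cohomologous_nil _ H); rewrite -TS M2_nil
  | apply: (cohomologous_nil _ H'); rewrite -ST M2_nil].
Qed.

Section NatFunEnds.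
Variables (R : comPzRingType) (A B : ainfCat R) (F G : ainfFun A B).
Variables (T : prenatural F G 0) (Tc : nat_closed T).
Variable Ti : forall x : A, invertible (T _ _ (cnil x)).

Lemma srcFun_natFun : acomp (srcFun B) (natFun Tc Ti) = F.
Proof.
case: F T Tc Ti => F0 F1 FP T' Tc' Ti'; apply: ainfFun_eq => x z p.
exact: comp_strict.
Qed.

Lemma tgtFun_natFun : acomp (tgtFun B) (natFun Tc Ti) = G.
Proof.
case: G T Tc Ti => F0 F1 FP T' Tc' Ti'; apply: ainfFun_eq => x z p.
exact: comp_strict.
Qed.

End NatFunEnds.

Theorem theoremC (R : comPzRingType) (A B : ainfCat R) (F G : ainfFun A B) :
  weakly_equivalent F G -> ho_class F = ho_class G.
Proof.
case/weakly_equivalent_invertible => T [Tc Ti].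
rewrite -[in LHS](srcFun_natFun Tc Ti) -[in RHS](tgtFun_natFun Tc Ti).
by rewrite (ho_class_comp (srcFun B)) (ho_class_comp (tgtFun B))
  ho_srcFun_tgtFun.
Qed.
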